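(* Let $G$ be a finitely generated discrete group, with a word metric. If $G$ has a combing of polynomial growth, then $H^n(\mathscr{S}^\infty G)\cong H^n(G)$ for all $n\in\mathbb{N}$. If $G$ has a combing of subexponential growth, then $H^n(\mathscr{S}^\omega G)\cong H^n(G)$ for all $n\in\mathbb{N}$. If $G$ has a combing of exponential growth, then $H^n(\mathscr{O}G)\cong H^n(G)$ for all $n\in\mathbb{N}$.
   Context: $G$ carries the word length function $\ell$ for a finite generating set and the left invariant word metric $d(g,h)=\ell(g^{-1}h)$; the base point is $\star=1$, so $\ell(g)=d(g,\star)$. Combings. A combing on $G$ is a sequence of maps (not necessarily homomorphisms) $f_n\colon G\to G$, $n\in\mathbb{N}=\{0,1,2,\dots\}$, such that: for all $x\in G$, $f_0(x)=\star$ and there is $n$ with $f_N(x)=x$ for all $N\ge n$; there is $C>0$ with $d(f_n(x),f_n(y))\le C(d(x,y)+1)$ for all $x,y\in G$, $n\in\mathbb{N}$; there is $S\in\mathbb{N}$ with $d(f_n(x),f_{n+1}(x))\le S$ for all $x\in G$, $n\in\mathbb{N}$. Let $J(x)$ be the (finite) number of $n\in\mathbb{N}$ with $f_n(x)\ne f_{n+1}(x)$. The combing has polynomial growth if $J(x)\le C(\ell(x)+1)^m$ for some $C>0$, $m\in\mathbb{N}$ and all $x$; subexponential growth if for every $\alpha>1$ there is $C>0$ with $J(x)\le C\alpha^{\ell(x)}$ for all $x$; exponential growth if there are $C>0$, $\alpha>1$ with $J(x)\le C\alpha^{\ell(x)}$ for all $x$. Group cohomology. Let $\mathscr{C}^n(G)$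 be the space of all functions $G^n\to\mathbb{R}$ ($\mathscr{C}^0(G)=\mathbb{R}$), with coboundary $$\delta\phi(g_1,\dots,g_{n+1})=\phi(g_2,\dots,g_{n+1})+\sum_{j=1}^n(-1)^j\phi(g_1,\dots,g_jg_{j+1},\dots,g_{n+1})+(-1)^{n+1}\phi(g_1,\dots,g_n).$$ Its cohomology is $H^n(G)$. The cohomologies $H^n(\mathscr{S}^\infty G)$, $H^n(\mathscr{S}^\omega G)$ and $H^n(\mathscr{O}G)$ are those of the subcomplexes of $\mathscr{C}^\bullet(G)$ of cochains $\phi$ satisfying, respectively: there are $k\in\mathbb{N}$, $C>0$ with $|\phi(g_1,\dots,g_n)|\le C(\ell(g_1)+1)^k\cdots(\ell(g_n)+1)^k$ (polynomial growth); for every $\alpha>1$ there is $C>0$ with $|\phi(g_1,\dots,g_n)|\le C\alpha^{\ell(g_1)+\dots+\ell(g_n)}$ (subexponential growth); there are $\alpha>1$, $C>0$ with $|\phi(g_1,\dots,g_n)|\le C\alpha^{\ell(g_1)+\dots+\ell(g_n)}$ (exponential growth). *)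

(* Defs.v *)
From HB Require Import structures.
From mathcomp Require Import all_boot all_order all_algebra.
From mathcomp Require Import ring_quotient finmap ring.
From mathcomp Require Import boolp classical_sets functions cardinality reals.

Set Implicit Arguments.
Unset Strict Implicit.
Unset Printing Implicit Defensive.

Import Order.TTheory GRing.Theory Num.Theory.
Local Open Scope ring_scope.

(* [Quotient.quot] only carries the structure of an abelian group.            *)
Section ModuleQuotient.
Variables (K : pzRingType) (V : lmodType K) (W : submodClosed V).
Local Open Scope quotient_scope.

Definition submod_pred : {pred V} := W.

Fact submod_pred_zmod : zmod_closed submod_pred.
Proof. exact: submodClosedP W. Qed.

HB.instance Definition _ := GRing.isZmodClosed.Build V submod_pred submod_pred_zmod.

Definition module_quot := Quotient.quot submod_pred.

HB.instance Definition _ := GRing.Zmodule.on module_quot.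

Definition qclass (v : V) : module_quot := \pi_(Quotient.quot submod_pred) v.

Definition qscale (a : K) (q : module_quot) : module_quot :=
  qclass (a *: repr (q : Quotient.quot submod_pred)).

Lemma qclass_eq (u v : V) : (qclass u == qclass v) = (u - v \in W).
Proof. by rewrite (Quotient.idealrBE submod_pred). Qed.

Lemma qclassD : {morph qclass : u v / u + v}.
Proof. by move=> u v; rewrite /qclass raddfD. Qed.

Lemma qclass_repr (q : module_quot) : qclass (repr (q : Quotient.quot submod_pred)) = q.
Proof. exact: reprK. Qed.

Lemma qclassZ (a : K) (v : V) : qclass (a *: v) = qscale a (qclass v).
Proof.
apply/eqP; rewrite /qscale qclass_eq -scalerBr (@rpredZ _ _ W) //.
by rewrite -qclass_eq qclass_repr.
Qed.

Fact qscaleA a b q : qscale a (qscale b q) = qscale (a * b) q.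
Proof. by rewrite -(qclass_repr q) -!qclassZ scalerA. Qed.
Fact qscale1 : left_id 1 qscale.
Proof. by move=> q; rewrite -{1}(qclass_repr q) -qclassZ scale1r qclass_repr. Qed.
Fact qscaleDr : right_distributive qscale +%R.
Proof.
move=> a p q; rewrite -(qclass_repr p) -(qclass_repr q).
by rewrite -qclassD -!qclassZ scalerDr qclassD.
Qed.
Fact qscaleDl q : {morph qscale^~ q : a b / a + b}.
Proof. by move=> a b; rewrite -(qclass_repr q) -!qclassZ scalerDl qclassD. Qed.

HB.instance Definition _ := GRing.Zmodule_isLmodule.Build K module_quot
  qscaleA qscale1 qscaleDr qscaleDl.

Fact qclass_is_linear : linear qclass.
Proof. by move=> a u v; rewrite qclassD qclassZ. Qed.

HB.instance Definition _ :=
  GRing.isLinear.Build K V module_quot _ qclass qclass_is_linear.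

End ModuleQuotient.

Section WordMetric.
Variable G : groupType.
Local Open Scope group_scope.

Definition is_word (S : seq G) (g : G) (n : nat) : Prop :=
  exists w : seq G,
    [/\ size w = n, {in w, forall s, s \in S \/ s^-1 \in S} &
        \prod_(s <- w) s = g].

Definition generates (S : seq G) : Prop := forall g, exists n, is_word S g n.

Lemma generates_asbool (S : seq G) (genS : generates S) (g : G) :
  exists n, `[< is_word S g n >].
Proof. by have [n gn] := genS g; exists n; apply/asboolP. Qed.

Definition word_length (S : seq G) (genS : generates S) (g : G) : nat :=
  ex_minn (generates_asbool genS g).

Definition word_dist (ell : G -> nat) (g h : G) : nat := ell (g^-1 * h).

End WordMetric.

Section Combing.
Variables (R : realType) (G : groupType) (ell : G -> nat).
Implicit Type f : nat -> G -> G.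
Local Notation d := (word_dist ell).

Definition is_combing f : Prop :=
  [/\ forall x, f 0%N x = 1%g,
      forall x, exists n, forall N, (n <= N)%N -> f N x = x,
      exists C : R, 0 < C /\
        forall x y n, (d (f n x) (f n y))%:R <= C * (d x y + 1)%:R &
      exists S : nat, forall x n, (d (f n x) (f n.+1 x) <= S)%N].

(* For a combing the set below is finite; [fset_set] would return the empty   *)
(* set on an infinite one.                                                    *)
Definition jumps f (x : G) : nat :=
  #|` fset_set [set n : nat | f n x <> f n.+1 x]%classic |.

Definition has_polynomial_combing : Prop :=
  exists f, is_combing f /\
  exists C : R, exists m : nat, 0 < C /\
    forall x, (jumps f x)%:R <= C * (ell x + 1)%:R ^+ m.

Definition has_subexponential_combing : Prop :=
  exists f, is_combing f /\
  forall alpha : R, 1 < alpha -> exists C : R, 0 < C /\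
    forall x, (jumps f x)%:R <= C * alpha ^+ ell x.

Definition has_exponential_combing : Prop :=
  exists f, is_combing f /\
  exists C alpha : R, [/\ 0 < C, 1 < alpha &
    forall x, (jumps f x)%:R <= C * alpha ^+ ell x].

End Combing.

Section Cochains.
Variables (R : realType) (G : groupType).

Definition cochain (n : nat) : Type := G ^ n -> R.

HB.instance Definition _ n := GRing.Lmodule.copy (cochain n) (G ^ n -> R^o).

(* Indices are shifted: the entries of g are g_0, ..., g_n, and the j-th      *)
(* inner face multiplies g_j with g_(j+1), for 0 <= j < n.                    *)
Definition first_face n (g : G ^ n.+1) : G ^ n := [ffun i => g (lift ord0 i)].

Definition last_face n (g : G ^ n.+1) : G ^ n := [ffun i => g (lift ord_max i)].

Definition inner_face n (j : 'I_n) (g : G ^ n.+1) : G ^ n :=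
  [ffun i : 'I_n =>
     if (i < j)%N then g (lift ord_max i)
     else if i == j then (g (lift ord_max i) * g (lift ord0 i))%g
     else g (lift ord0 i)].

Definition coboundary n (phi : cochain n) : cochain n.+1 := fun g =>
  phi (first_face g)
  + \sum_(j < n) (-1) ^+ j.+1 * phi (inner_face j g)
  + (-1) ^+ n.+1 * phi (last_face g).

Lemma coboundary_is_linear n : linear (@coboundary n).
Proof.
move=> a u v; apply/funext => g.
have E m (p q : cochain m) h : (a *: p + q) h = a * p h + q h by [].
rewrite E /coboundary !E; under eq_bigr do rewrite E mulrDr mulrCA.
rewrite big_split -mulr_sumr /=; ring.
Qed.

HB.instance Definition _ n :=
  GRing.isLinear.Build R (cochain n) (cochain n.+1) _ (@coboundary n)
    (@coboundary_is_linear n).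

Definition is_coboundary (P : forall n, {pred cochain n}) (n : nat) :
    cochain n -> Prop :=
  match n with
  | 0 => fun phi => phi = 0
  | m.+1 => fun phi => exists2 psi : cochain m, psi \in P m & phi = coboundary psi
  end.

(* P is meant to be stable under coboundaries, i.e. to define a subcomplex;   *)
(* [coboundaries] is then the image of [coboundary] on P in degree n-1.       *)
Section Cohomology.
Variables (P : forall n, submodClosed (cochain n)) (n : nat).

Definition is_cocycle : {pred cochain n} :=
  fun phi => (phi \in P n) && (coboundary phi == 0).

Fact is_cocycle_submod : subsemimod_closed is_cocycle.
Proof.
split; first split; first by rewrite unfold_in rpred0 raddf0 eqxx.
- move=> u v /andP[uP /eqP u0] /andP[vP /eqP v0].
  by rewrite unfold_in rpredD // raddfD /= u0 v0 addr0 eqxx.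
- move=> a u /andP[uP /eqP u0].
  by rewrite unfold_in rpredZ // linearZ /= u0 scaler0 eqxx.
Qed.

HB.instance Definition _ :=
  GRing.isSubmodClosed.Build R (cochain n) is_cocycle is_cocycle_submod.

Record cocycle : Type :=
  Cocycle { cocycle_val :> cochain n; _ : is_cocycle cocycle_val }.

HB.instance Definition _ := [isSub for cocycle_val].
HB.instance Definition _ := [Choice of cocycle by <:].
HB.instance Definition _ := [SubChoice_isSubLmodule of cocycle by <:].

Definition coboundaries : {pred cocycle} :=
  fun z => `[< is_coboundary P (z : cochain n) >].

Fact coboundaries_submod : subsemimod_closed coboundaries.
Proof.
suff [B0 BD BZ] : [/\ @is_coboundary P n 0,
    forall u v, @is_coboundary P n u -> @is_coboundary P n v ->
      @is_coboundary P n (u + v) &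
    forall a u, @is_coboundary P n u -> @is_coboundary P n (a *: u)].
  split; first split; first exact/asboolP.
  - by move=> u v /asboolP uB /asboolP vB; apply/asboolP; apply: BD.
  - by move=> a u /asboolP uB; apply/asboolP; apply: BZ.
case: n => [|m] /=.
  by split=> [|u v -> ->|a u ->] //; rewrite ?addr0 ?scaler0.
split=> [|u v [p pP ->] [q qP ->]|a u [p pP ->]].
- by exists 0; rewrite ?rpred0 ?raddf0.
- by exists (p + q); rewrite ?rpredD ?raddfD.
- by exists (a *: p); rewrite ?rpredZ ?linearZ.
Qed.

HB.instance Definition _ :=
  GRing.isSubmodClosed.Build R cocycle coboundaries coboundaries_submod.

Definition cohomology := module_quot coboundaries.

HB.instance Definition _ := GRing.Lmodule.on cohomology.

Definition cohomology_class (z : cocycle) : cohomology := qclass coboundaries z.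

End Cohomology.

Definition all_cochain (n : nat) : {pred cochain n} := fun=> true.

Fact all_cochain_submod n : subsemimod_closed (@all_cochain n).
Proof. by []. Qed.

HB.instance Definition _ n := GRing.isSubmodClosed.Build R (cochain n)
  (@all_cochain n) (@all_cochain_submod n).

Definition all_cochains (n : nat) : submodClosed (cochain n) := @all_cochain n.

(* The isomorphism is the one induced by the inclusion of the subcomplex P in *)
(* the complex of all cochains.                                               *)
Definition inclusion_iso (P : forall n, submodClosed (cochain n)) (n : nat)
    : Prop :=
  exists Phi : {linear cohomology P n -> cohomology all_cochains n},
    bijective Phi /\
    forall (z : cocycle P n) (w : cocycle all_cochains n),
      z = w :> cochain n ->
      Phi (cohomology_class z) = cohomology_class w.

Section Growth.
Variable ell : G -> nat.

Definition has_polynomial_growth n (phi : cochain n) : Prop :=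
  exists k : nat, exists C : R, 0 < C /\
    forall g, `|phi g| <= C * \prod_(i < n) (ell (g i) + 1)%:R ^+ k.

Definition has_subexponential_growth n (phi : cochain n) : Prop :=
  forall alpha : R, 1 < alpha -> exists C : R, 0 < C /\
    forall g, `|phi g| <= C * alpha ^+ (\sum_(i < n) ell (g i)).

Definition has_exponential_growth n (phi : cochain n) : Prop :=
  exists alpha C : R, [/\ 1 < alpha, 0 < C &
    forall g, `|phi g| <= C * alpha ^+ (\sum_(i < n) ell (g i))].

Definition polynomial_cochain n : {pred cochain n} :=
  fun phi => `[< has_polynomial_growth phi >].

Definition subexponential_cochain n : {pred cochain n} :=
  fun phi => `[< has_subexponential_growth phi >].

Definition exponential_cochain n : {pred cochain n} :=
  fun phi => `[< has_exponential_growth phi >].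

Let boundD n (u v : cochain n) (g : G ^ n) (C D A B M : R) :
  0 < C -> 0 < D -> A <= M -> B <= M ->
  `|u g| <= C * A -> `|v g| <= D * B -> `|(u + v) g| <= (C + D) * M.
Proof.
move=> C0 D0 AM BM uA vB.
have -> : (u + v) g = u g + v g by [].
apply: le_trans (ler_normD _ _) _; rewrite mulrDl.
by apply: lerD; [apply: le_trans uA _|apply: le_trans vB _];
  rewrite ler_pM2l.
Qed.

Let boundZ n (a : R) (u : cochain n) (g : G ^ n) (C A : R) :
  0 < C -> 0 <= A -> `|u g| <= C * A -> `|(a *: u) g| <= (`|a| + 1) * C * A.
Proof.
move=> C0 A0 uA.
have -> : (a *: u) g = a * u g by [].
rewrite normrM -mulrA; apply: ler_pM => //.
by rewrite lerDl.
Qed.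

Let prod_ge0 n (g : G ^ n) k :
  0 <= \prod_(i < n) (ell (g i) + 1)%:R ^+ k :> R.
Proof. by apply: prodr_ge0 => i _; rewrite exprn_ge0. Qed.

Let norm1_gt0 (a : R) : 0 < `|a| + 1.
Proof. by rewrite ltr_wpDl. Qed.

Fact polynomial_cochain_submod n : subsemimod_closed (@polynomial_cochain n).
Proof.
split; first split; first apply/asboolP.
- by exists 0%N, 1; split=> // g; rewrite normr0 mul1r.
- move=> u v /asboolP[k [C [C0 uC]]] /asboolP[l [D [D0 vD]]]; apply/asboolP.
  exists (maxn k l), (C + D); split=> [|g]; first exact: addr_gt0.
  apply: boundD (uC g) (vD g) => //; apply: ler_prod => i _;
    by rewrite exprn_ge0 // ler_weXn2l ?leq_maxl ?leq_maxr // ler1n addn1.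
- move=> a u /asboolP[k [C [C0 uC]]]; apply/asboolP.
  exists k, ((`|a| + 1) * C); split=> [|g]; first exact: mulr_gt0.
  exact: boundZ.
Qed.

Fact subexponential_cochain_submod n :
  subsemimod_closed (@subexponential_cochain n).
Proof.
have pw_ge0 (alpha : R) k : 1 < alpha -> 0 <= alpha ^+ k.
  by move=> a1; rewrite exprn_ge0 // ltW // (lt_trans ltr01).
split; first split; first apply/asboolP.
- by move=> alpha a1; exists 1; split=> // g; rewrite normr0 mul1r pw_ge0.
- move=> u v /asboolP uS /asboolP vS; apply/asboolP => alpha a1.
  have [[C [C0 uC]] [D [D0 vD]]] := (uS _ a1, vS _ a1).
  exists (C + D); split=> [|g]; first exact: addr_gt0.
  exact: boundD (uC g) (vD g).
- move=> a u /asboolP uS; apply/asboolP => alpha a1; have [C [C0 uC]] := uS _ a1.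
  exists ((`|a| + 1) * C); split=> [|g]; first exact: mulr_gt0.
  by apply: boundZ => //; apply: pw_ge0.
Qed.

Fact exponential_cochain_submod n : subsemimod_closed (@exponential_cochain n).
Proof.
have pw_ge0 (alpha : R) k : 1 < alpha -> 0 <= alpha ^+ k.
  by move=> a1; rewrite exprn_ge0 // ltW // (lt_trans ltr01).
split; first split; first apply/asboolP.
- exists 2, 1; split=> [||g] //; first by rewrite ltr1n.
  by rewrite normr0 mul1r pw_ge0 // ltr1n.
- move=> u v /asboolP[a [C [a1 C0 uC]]] /asboolP[b [D [b1 D0 vD]]].
  have [a0 b0] : 0 <= a /\ 0 <= b by rewrite !ltW // (lt_trans ltr01).
  apply/asboolP; exists (Num.max a b), (C + D); split=> [||g].
  + by rewrite lt_max a1.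
  + exact: addr_gt0.
  apply: boundD (uC g) (vD g) => //;
    by apply: lerXn2r; rewrite ?nnegrE ?le_max ?lexx ?a0 ?orbT.
- move=> a u /asboolP[b [C [b1 C0 uC]]]; apply/asboolP.
  exists b, ((`|a| + 1) * C); split=> [||g] //; first exact: mulr_gt0.
  by apply: boundZ => //; apply: pw_ge0.
Qed.

HB.instance Definition _ n := GRing.isSubmodClosed.Build R (cochain n)
  (@polynomial_cochain n) (@polynomial_cochain_submod n).
HB.instance Definition _ n := GRing.isSubmodClosed.Build R (cochain n)
  (@subexponential_cochain n) (@subexponential_cochain_submod n).
HB.instance Definition _ n := GRing.isSubmodClosed.Build R (cochain n)
  (@exponential_cochain n) (@exponential_cochain_submod n).

Definition polynomial_cochains n : submodClosed (cochain n) :=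
  @polynomial_cochain n.
Definition subexponential_cochains n : submodClosed (cochain n) :=
  @subexponential_cochain n.
Definition exponential_cochains n : submodClosed (cochain n) :=
  @exponential_cochain n.

End Growth.

End Cochains.

(* Main.v *)
From HB Require Import structures.
Require Import Defs.
From mathcomp Require Import all_boot all_order all_algebra.
From mathcomp Require Import finmap ring zify.
From mathcomp Require Import boolp classical_sets functions cardinality.
From mathcomp Require Import reals.

(** Group cohomology is computed by homogeneous cochains: functions on simplices
    (x0, ..., xn) of group elements that do not change when all vertices are
    translated.  Write [d] for the simplicial boundary.  The theorem follows from
    an equivariant chain map [u] and an equivariant chain homotopy [h] from [u]
    to the identity such that
    - [u] sends a simplex to a combination of simplices whose consecutive vertices
      have distance at most a constant depending on the dimension only, and the
      number of these simplices has the growth in question.  Up to translation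
      there are finitely many such simplices, so [phi \o u] has this growth for
      every cochain [phi] whatsoever;
    - [h] sends a simplex to a combination of simplices whose size is linear in
      that of the given one, and whose number again has the growth in question.
      So [phi \o h] has this growth as soon as [phi] does.
    The identity 1 - u = h d + d h then shows that every cocycle is cohomologous
    to one of controlled growth, and that a cocycle of controlled growth which
    is a coboundary is the coboundary of a cochain of controlled growth
    ([inclusion_iso_homotopy]).

    The combing gives a contraction [s] of the simplicial complex, s d + d s = 1,
    which is not equivariant: sum the prisms between consecutive maps f_k and
    f_(k+1), and end with the cone over the constant map f_0
    ([fill_upto_sdiff]).  A prism between equal maps consists of degenerate
    simplices but is not zero.  Therefore the prism from f_k to itself is
    subtracted from the one from f_k to f_(k+1): the boundary relation does not
    change, and only the finitely many times k at which a vertex of the simplex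
    jumps contribute.  This is how the number of jumps enters the estimates
    ([fill_bound]).

    Let K be the cone with apex 1.  Every simplex is a translate of some K t, so
    equivariant maps are determined by their values on cones, and
      u K = s u,     h K = K (K - s u - h)
    define [u] and [h]; the relations d u = u d and 1 - u = h d + d h are formal
    consequences of those of [s] and K ([small_sdiff], [homotopyP]).  In bar
    notation u [a1|...|an] = s a1 s a2 ... s an s (), a form in which the
    estimates follow by induction on n ([bar_fill_bound],
    [bar_homotopy_bound]).

    Simplices are lists of group elements, so that faces and prisms are defined
    by structural recursion without dependent types, the empty list being the
    simplex of dimension -1 of the augmented complex.  All operators are written
    on functions of simplices, that is, as the transposes of the maps of chains
    described above. *)

Set Implicit Arguments.
Unset Strict Implicit.
Unset Printing Implicit Defensive.

Import Order.TTheory GRing.Theory Num.Theory.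
Local Open Scope ring_scope.

(** * Simplices as lists *)

Section Simplices.
Variables (R : comPzRingType) (T : eqType).
Implicit Types (phi psi : seq T -> R) (f : T -> T).

(** The recursion is d (x * s) = s - x * d s, where x * s is the cone over s with
    apex x.  In dimension 0 this is the augmentation. *)
Fixpoint sdiff phi (s : seq T) : R :=
  if s is x :: s' then phi s' - sdiff (fun t => phi (x :: t)) s' else 0.

Lemma sdiff_cons phi x s :
  sdiff phi (x :: s) = phi s - sdiff (fun t => phi (x :: t)) s.
Proof. by []. Qed.

Lemma sdiffB phi psi s :
  sdiff (fun t => phi t - psi t) s = sdiff phi s - sdiff psi s.
Proof. by elim: s phi psi => [|x s IH] phi psi /=; rewrite ?subrr // IH; ring. Qed.

Lemma sdiffD phi psi s :
  sdiff (fun t => phi t + psi t) s = sdiff phi s + sdiff psi s.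
Proof. by elim: s phi psi => [|x s IH] phi psi /=; rewrite ?addr0 // IH; ring. Qed.

Lemma sdiff_map f phi s : sdiff (fun t => phi (map f t)) s = sdiff phi (map f s).
Proof. by elim: s phi => [|x s IH] phi //=; rewrite -IH. Qed.

(** Faces only use vertices of the simplex. *)
Lemma eq_sdiff_sub phi psi s :
  (forall t, {subset t <= s} -> phi t = psi t) -> sdiff phi s = sdiff psi s.
Proof.
elim: s phi psi => [|x s IH] phi psi E //=.
rewrite E; last by move=> y; rewrite inE orbC => ->.
congr (_ - _); apply: IH => t ts; apply: E => y.
by rewrite !inE => /predU1P[-> | /ts ->]; rewrite ?eqxx ?orbT.
Qed.

Lemma sdiff_size phi n s : (forall t, size t != n -> phi t = 0) ->
  size s != n.+1 -> sdiff phi s = 0.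
Proof.
elim: s phi n => [|x s IH] phi n E //=; rewrite eqSS => sn.
case: n E sn => [|n] E sn; rewrite E ?sub0r //.
  case: s sn IH => [|y s] // _ IH; apply/eqP; rewrite oppr_eq0; apply/eqP.
  rewrite (@eq_sdiff_sub _ (fun=> 0)) => [|t _]; last exact: E.
  by elim: (y :: s) => //= ? ? ->; rewrite subr0.
by rewrite (IH _ n) ?oppr0 // => t tn; rewrite E.
Qed.

Lemma sdiff_sum phi s : sdiff phi s =
  \sum_(i < size s) (-1) ^+ i * phi (take i s ++ drop i.+1 s).
Proof.
elim: s phi => [|x s IH] phi /=; first by rewrite big_ord0.
rewrite big_ord_recl /= expr0 mul1r drop0 IH -sumrN; congr (_ + _).
by apply: eq_bigr => i _; rewrite exprS !mulN1r mulNr.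
Qed.

(** The alternating sum of (f x0, ..., f xi, f' xi, ..., f' xn), which
    triangulates the prism between the images of a simplex under f and f'. *)
Fixpoint prism f f' phi (s : seq T) : R :=
  if s is x :: s' then
    phi (f x :: f' x :: map f' s') - prism f f' (fun t => phi (f x :: t)) s'
  else 0.

Lemma prismB f f' phi psi s :
  prism f f' (fun t => phi t - psi t) s = prism f f' phi s - prism f f' psi s.
Proof. by elim: s phi psi => [|x s IH] phi psi /=; rewrite ?subrr // IH; ring. Qed.

Lemma prism_homotopy f f' phi s :
  prism f f' (sdiff phi) s + sdiff (prism f f' phi) s
    = phi (map f' s) - phi (map f s).
Proof.
elim: s phi => [|x s IH] phi /=; first by rewrite addr0 subrr.
have:= IH (fun t => phi (f x :: t)).
rewrite prismB sdiffB (sdiff_map f' (fun t => phi (f x :: f' x :: t))).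
move/eqP; rewrite -subr_eq0 => /eqP IHx.
by apply/eqP; rewrite -subr_eq0 -IHx; apply/eqP; ring.
Qed.

Lemma eq_prism f f' g g' phi s : {in s, f =1 g} -> {in s, f' =1 g'} ->
  prism f f' phi s = prism g g' phi s.
Proof.
elim: s phi => [|x s IH] phi //= E E'.
rewrite (E x) ?(E' x) ?mem_head // -IH; last first.
- by move=> y ys; apply: E'; rewrite inE ys orbT.
- by move=> y ys; apply: E; rewrite inE ys orbT.
congr (phi (_ :: _ :: _) - _); apply/eq_in_map => y ys.
by apply: E'; rewrite inE ys orbT.
Qed.

End Simplices.

(** * Equivariant maps built from a contraction *)

Section Filling.
Variables (R : comPzRingType) (G : groupType).
Variable fill : (seq G -> R) -> seq G -> R.
Hypothesis fillB : forall phi psi s,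
  fill (fun t => phi t - psi t) s = fill phi s - fill psi s.
Hypothesis fill_sdiff : forall phi s,
  fill (sdiff phi) s + sdiff (fill phi) s = phi s.
Implicit Types (phi psi : seq G -> R) (a g : G) (s l : seq G).

Definition translate g phi s := phi (map (fun x => g * x)%g s).
Definition cone phi s := phi (1%g :: s).
Definition quotients : G -> seq G -> seq G := pairmap (fun x y => x^-1 * y)%g.
Definition products : G -> seq G -> seq G := scanl (fun x y => x * y)%g.

Lemma quotientsK x : cancel (quotients x) (products x).
Proof. by apply: pairmapK => y z; rewrite mulVKg. Qed.
Lemma productsK x : cancel (products x) (quotients x).
Proof. by apply: scanlK => y z; rewrite mulKg. Qed.

Lemma quotients_translate g x s :
  quotients (g * x)%g (map (fun x => g * x)%g s) = quotients x s.
Proof.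
elim: s x => //= y s IH x; rewrite -/(quotients _ _) IH.
by rewrite invgM -mulgA mulKg.
Qed.

Lemma translateM g h phi : translate h (translate g phi) = translate (g * h)%g phi.
Proof.
apply/funext => s; rewrite /translate -map_comp; congr phi.
by apply: eq_map => x /=; rewrite mulgA.
Qed.

Lemma translate1 phi : translate 1%g phi = phi.
Proof.
by apply/funext => s; rewrite /translate (eq_map (@mul1g _)) map_id.
Qed.

Lemma sdiff_translate g phi : sdiff (translate g phi) = translate g (sdiff phi).
Proof. by apply/funext => s; apply: sdiff_map. Qed.

Lemma translateB g phi psi :
  translate g (fun s => phi s - psi s)
    = fun s => translate g phi s - translate g psi s.
Proof. by []. Qed.

(** In bar notation, the value of phi on u [a1|...|an] = s a1 s a2 ... s an s ();
    the recursion applies the outermost factor s a1 first, as functions are pulled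
    back. *)
Fixpoint bar_fill phi l : R :=
  if l is a :: l' then bar_fill (translate a (fill phi)) l' else fill phi [::].

(** The equivariant chain map [u]. *)
Definition small phi s : R :=
  if s is g :: s' then bar_fill (translate g phi) (quotients g s') else phi [::].

Lemma bar_fillB phi psi l :
  bar_fill (fun t => phi t - psi t) l = bar_fill phi l - bar_fill psi l.
Proof.
elim: l phi psi => [|a l IH] phi psi /=; first exact: fillB.
by rewrite -IH -translateB; congr bar_fill; congr translate; apply/funext => t.
Qed.

Lemma smallB phi psi s :
  small (fun t => phi t - psi t) s = small phi s - small psi s.
Proof. by case: s => [|g s] //=; rewrite translateB bar_fillB. Qed.

Lemma small_translate g phi : small (translate g phi) = translate g (small phi).
Proof.
apply/funext => -[|x s] //.
by rewrite [RHS]/translate /= quotients_translate translateM.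
Qed.

(** This is the relation u K = s u that determines [u]. *)
Lemma small_cone phi s : small phi (1%g :: s) = small (fill phi) s.
Proof. by case: s => [|g s] /=; rewrite translate1 // invg1 mul1g. Qed.

Lemma fill_sdiffE phi : fill (sdiff phi) = fun s => phi s - sdiff (fill phi) s.
Proof. by apply/funext => s; rewrite -[phi s]fill_sdiff addrK. Qed.

(** Translating the first vertex to 1 presents a nonempty simplex as a cone with
    apex 1 over a simplex of smaller dimension. *)
Lemma equivariant_ind (P : (seq G -> R) -> seq G -> Prop) :
  (forall g phi s, P (translate g phi) s -> P phi (map (fun x => g * x)%g s)) ->
  (forall phi, P phi [::]) ->
  (forall s, (forall phi, P phi s) -> forall phi, P phi (1%g :: s)) ->
  forall phi s, P phi s.
Proof.
move=> Ptr P0 Pcone phi s; have [n le_n] := ubnP (size s).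
elim: n s le_n phi => // n IH [|g s] //= le_n phi.
have -> : g :: s = map (fun x => g * x)%g (1%g :: map (fun x => g^-1 * x)%g s).
  by rewrite /= mulg1 (mapK (mulVKg g)).
by apply: Ptr; apply: Pcone => psi; apply: IH; rewrite size_map.
Qed.

(** On a cone K t, with d K = 1 - K d and d s = 1 - s d, both u d K t and d u K t
    equal u t - s u d t if u commutes with d below the dimension of K t. *)
Lemma small_sdiff phi s : small (sdiff phi) s = sdiff (small phi) s.
Proof.
move: phi s; apply: equivariant_ind => // [g phi s | s IH phi].
  rewrite sdiff_translate !small_translate sdiff_translate; exact.
rewrite small_cone fill_sdiffE smallB IH sdiff_cons; congr (_ - _).
by congr sdiff; apply/funext => t; rewrite small_cone.
Qed.

(** The value of phi on h [a1|...|an], from the relation h K = K (K - s u - h)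
    applied to the simplex (a1, a1 a2, ...). *)
Fixpoint bar_homotopy phi l : R :=
  cone phi (1%g :: products 1%g l) - bar_fill (cone phi) l
  - (if l is a :: l' then bar_homotopy (translate a (cone phi)) l' else 0).

Definition homotopy phi s : R :=
  if s is g :: s' then bar_homotopy (translate g phi) (quotients g s') else 0.

Lemma coneB phi psi :
  cone (fun s => phi s - psi s) = fun s => cone phi s - cone psi s.
Proof. by []. Qed.

Lemma bar_homotopyE phi l : bar_homotopy phi l =
  cone phi (1%g :: products 1%g l) - bar_fill (cone phi) l
  - (if l is a :: l' then bar_homotopy (translate a (cone phi)) l' else 0).
Proof. by case: l. Qed.

Lemma bar_homotopyB phi psi l : bar_homotopy (fun t => phi t - psi t) l =
  bar_homotopy phi l - bar_homotopy psi l.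
Proof.
elim: l phi psi => [|a l IH] phi psi;
    rewrite bar_homotopyE [in RHS](bar_homotopyE phi) [in RHS](bar_homotopyE psi).
  by rewrite coneB bar_fillB; ring.
by rewrite coneB bar_fillB translateB IH; ring.
Qed.

Lemma homotopyB phi psi s :
  homotopy (fun t => phi t - psi t) s = homotopy phi s - homotopy psi s.
Proof.
by case: s => [|g s] /=; rewrite ?subrr // translateB bar_homotopyB.
Qed.

Lemma homotopy_translate g phi :
  homotopy (translate g phi) = translate g (homotopy phi).
Proof.
apply/funext => -[|x s] //.
by rewrite [RHS]/translate /= quotients_translate translateM.
Qed.

(** This is the relation h K = K (K - u K - h), which determines [h]. *)
Lemma homotopy_cone phi s : homotopy phi (1%g :: s) =
  cone phi (1%g :: s) - small (cone phi) (1%g :: s) - homotopy (cone phi) s.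
Proof.
case: s => [|g s]; rewrite /homotopy /small !translate1 /= ?invg1 ?mul1g //.
by rewrite quotientsK.
Qed.

(** Again it suffices to treat a cone K t, and there the identity follows from
    the one for t by d K = 1 - K d and the two relations for cones. *)
Lemma homotopyP phi s :
  phi s - small phi s = homotopy (sdiff phi) s + sdiff (homotopy phi) s.
Proof.
move: phi s; apply: equivariant_ind => [g phi s | phi | s IH phi].
- rewrite sdiff_translate !small_translate !homotopy_translate sdiff_translate.
  exact.
- by rewrite /= subrr addr0.
rewrite homotopy_cone.
have -> : cone (sdiff phi) = fun t => phi t - sdiff (cone phi) t by [].
rewrite smallB homotopyB small_sdiff !sdiff_cons.
have -> : (fun t => homotopy phi (1%g :: t)) =
    fun t => (cone (cone phi) t - cone (small (cone phi)) t)
      - homotopy (cone phi) t.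
  by apply/funext => t; rewrite homotopy_cone.
have := IH (cone phi); rewrite !sdiffB /cone /=.
move/eqP; rewrite -subr_eq0 => /eqP IHx.
by apply/eqP; rewrite -subr_eq0 -IHx; apply/eqP; ring.
Qed.

End Filling.

(** * The contraction given by a combing *)

Section CombingFill.
Variables (R : comPzRingType) (G : groupType) (f : nat -> G -> G) (stab : G -> nat).
Hypothesis f0 : forall x, f 0%N x = 1%g.
Hypothesis stabP : forall x n, (stab x <= n)%N -> f n x = x.
Implicit Types (phi psi : seq G -> R) (s : seq G).

(** The prism from f_n to itself anticommutes with the boundary, so subtracting
    it leaves the homotopy relation intact, and it cancels the degenerate
    simplices that appear when f_n and f_(n+1) agree on the vertices. *)
Definition step n phi s : R :=
  prism (f n) (f n.+1) phi s - prism (f n) (f n) phi s.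

Fixpoint fill_upto n phi s : R :=
  if n is n'.+1 then fill_upto n' phi s + step n' phi s
  else phi (1%g :: map (f 0) s).

(** From this time on the combing fixes all vertices of s, hence those of every
    face of s. *)
Definition stab_time s := (\max_(x <- s) stab x)%N.

Definition fill phi s := fill_upto (stab_time s) phi s.

Lemma step_fixed n phi s : {in s, f n =1 f n.+1} -> step n phi s = 0.
Proof.
move=> fs; rewrite /step (@eq_prism _ _ (f n) (f n.+1) (f n) (f n)) ?subrr //.
by move=> x xs; rewrite fs.
Qed.

Lemma fill_uptoB n phi psi s : fill_upto n (fun t => phi t - psi t) s =
  fill_upto n phi s - fill_upto n psi s.
Proof. by elim: n => //= n ->; rewrite /step !prismB; ring. Qed.

Lemma fillB phi psi s : fill (fun t => phi t - psi t) s = fill phi s - fill psi s.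
Proof. exact: fill_uptoB. Qed.

(** The steps telescope from f_0 to f_n, and the cone contracts the constant
    simplex f_0 s. *)
Lemma fill_upto_sdiff n phi s :
  fill_upto n (sdiff phi) s + sdiff (fill_upto n phi) s = phi (map (f n) s).
Proof.
elim: n => [|n IH].
  rewrite /= (sdiff_map (f 0) (fun t => phi (1%g :: t))).
  have -> : map (f 0) s = map (fun=> 1%g) s by apply: eq_map.
  by rewrite subrK.
have stepE : step n (sdiff phi) s + sdiff (step n phi) s
    = phi (map (f n.+1) s) - phi (map (f n) s).
  rewrite /step sdiffB addrACA -opprD !prism_homotopy subrr subr0 //.
have -> : fill_upto n.+1 phi = fun t => fill_upto n phi t + step n phi t by [].
by rewrite sdiffD /= addrACA IH stepE addrC subrK.
Qed.

Lemma leq_stab_time s x : x \in s -> (stab x <= stab_time s)%N.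
Proof. by move=> xs; rewrite /stab_time; apply: leq_bigmax_seq. Qed.

Lemma fill_upto_stab n phi s : (stab_time s <= n)%N -> fill_upto n phi s = fill phi s.
Proof.
move=> /subnK <-; elim: (n - _)%N => //= m ->; rewrite step_fixed ?addr0 // => x xs.
have xm := leq_stab_time xs.
by rewrite !stabP // (leq_trans xm) // ?leqW // leq_addl.
Qed.

Lemma fill_sdiff phi s : fill (sdiff phi) s + sdiff (fill phi) s = phi s.
Proof.
have -> : sdiff (fill phi) s = sdiff (fill_upto (stab_time s) phi) s.
  apply: eq_sdiff_sub => t ts; rewrite fill_upto_stab //.
  by apply/bigmax_leqP_seq => x xt _; apply: leq_stab_time; apply: ts.
rewrite fill_upto_sdiff; congr phi; rewrite -[RHS]map_id.
by apply/eq_in_map => x xs; rewrite stabP ?leq_stab_time.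
Qed.

End CombingFill.

(** * Homogeneous and inhomogeneous cochains *)

Section Homogenization.
Variables (R : realType) (G : groupType).
Local Notation C := (@cochain R G).
Implicit Types F : seq G -> R.

Definition translation_invariant F := forall a, translate a F = F.

(** The bar simplex [g1|...|gn] is the simplex (1, g1, g1 g2, ...). *)
Definition vertices n (g : G ^ n) : seq G := 1%g :: products 1%g (codom g).

Definition inhomogeneous F n : C n := fun g => F (vertices g).

(** The value 0 in the dimensions other than n makes [sdiff_homogeneous] an
    identity of functions of simplices of all dimensions. *)
Definition homogeneous n (phi : C n) (s : seq G) : R :=
  if s is x :: s' then
    if size s' == n then phi [ffun i : 'I_n => nth 1%g (quotients x s') i] else 0
  else 0.

Arguments inhomogeneous : clear implicits.

Lemma homogeneous_invariant n (phi : C n) :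
  translation_invariant (homogeneous phi).
Proof.
move=> a; apply/funext => -[|x s] //; rewrite /translate /= size_map.
by rewrite quotients_translate.
Qed.

Lemma nth_codom_ffun n (g : G ^ n) (i : 'I_n) : nth 1%g (codom g) i = g i.
Proof. by rewrite (nth_map i) ?size_enum_ord // nth_ord_enum. Qed.

Lemma size_vertices n (g : G ^ n) : size (vertices g) = n.+1.
Proof. by rewrite /vertices /= size_scanl size_codom card_ord. Qed.

Lemma homogeneousK n (phi : C n) : inhomogeneous (homogeneous phi) n = phi.
Proof.
apply/funext => g; rewrite /inhomogeneous /homogeneous.
have /= := size_vertices g; rewrite /vertices => -[->]; rewrite eqxx productsK.
by congr phi; apply/ffunP => i; rewrite ffunE nth_codom_ffun.
Qed.

Lemma homogeneous_size n (phi : C n) s : size s != n.+1 -> homogeneous phi s = 0.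
Proof. by case: s => //= x s; rewrite eqSS => /negbTE->. Qed.

(** An invariant function on n-simplices is determined by the simplices whose
    first vertex is 1. *)
Lemma invariant_inj n F F' : translation_invariant F -> translation_invariant F' ->
  (forall s, size s != n.+1 -> F s = 0) ->
  (forall s, size s != n.+1 -> F' s = 0) ->
  inhomogeneous F n = inhomogeneous F' n -> F = F'.
Proof.
move=> Fi F'i F0 F'0 FF'; apply/funext => s.
have [ss|] := eqVneq (size s) n.+1; last by move=> ns; rewrite F0 ?F'0.
case: s ss => //= x s [ss].
suff sE : x :: s = map (fun y => x * y)%g
    (vertices [ffun i : 'I_n => nth 1%g (quotients x s) i]).
  rewrite sE -!/(translate x _ _) Fi F'i.
  exact: (congr1 (fun f => f _) FF').
have -> : x :: s = map (fun y => x * y)%g (map (fun y => x^-1 * y)%g (x :: s)).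
  by rewrite (mapK (mulVKg x)).
congr map; rewrite /= mulVg /vertices; congr cons.
rewrite -[LHS](quotientsK 1%g); congr products.
have := quotients_translate x^-1 x s; rewrite mulVg => ->.
apply: (@eq_from_nth _ 1%g) => [|i].
  by rewrite size_pairmap size_codom card_ord.
rewrite size_pairmap ss => lt_in.
by rewrite (nth_codom_ffun _ (Ordinal lt_in)) ffunE.
Qed.

Definition partial_product (v : nat -> G) i : G := (\prod_(0 <= k < i) v k)%g.

Lemma verticesE n (g : G ^ n) :
  vertices g = mkseq (partial_product (nth 1%g (codom g))) n.+1.
Proof.
apply: (@eq_from_nth _ 1%g) => [|i]; rewrite size_vertices ?size_mkseq //.
move=> lt_in; rewrite nth_mkseq //.
case: i lt_in => [|i] lt_in; first by rewrite /partial_product big_nil.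
have sg : size (codom g) = n by rewrite size_codom card_ord.
rewrite /= nth_scanl ?sg //; elim: i lt_in => [|i IH] lt_in.
  rewrite /partial_product big_nat1; case: (codom g) sg => [|x l] /=.
    by move=> n0; rewrite -n0 in lt_in.
  by rewrite take0 /= mul1g.
rewrite (take_nth 1%g) ?sg // -cats1 foldl_cat /= IH ?(ltnW lt_in) //.
by rewrite /partial_product [RHS]big_nat_recr.
Qed.

Lemma delete_mkseq (v : nat -> G) n i : (i <= n)%N ->
  take i (mkseq v n.+1) ++ drop i.+1 (mkseq v n.+1) = mkseq (v \o bump i) n.
Proof.
move=> le_in; have st : size (take i (mkseq v n.+1)) = i.
  by rewrite size_take size_mkseq ltnS le_in.
have ss : size (take i (mkseq v n.+1) ++ drop i.+1 (mkseq v n.+1)) = n.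
  by rewrite size_cat st size_drop size_mkseq subSS subnKC.
apply: (@eq_from_nth _ 1%g) => [|k]; rewrite ss ?size_mkseq // => lt_kn.
rewrite nth_cat st [in RHS]nth_mkseq // /comp /bump.
case: ltnP => ik; first by rewrite nth_take // nth_mkseq // ltnW.
by rewrite nth_drop addSn subnKC // nth_mkseq.
Qed.

Lemma vertices_last_face n (g : G ^ n.+1) : vertices (last_face g) =
  mkseq (partial_product (nth 1%g (codom g)) \o bump n.+1) n.+1.
Proof.
rewrite verticesE; apply/eq_in_map => i; rewrite mem_iota /= => lt_in.
rewrite /bump leqNgt lt_in add0n /partial_product.
apply: eq_big_nat => k /andP[_ lt_ki].
have lt_kn : (k < n)%N by lia.
rewrite (nth_codom_ffun _ (Ordinal lt_kn)) ffunE.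
by rewrite -nth_codom_ffun /= /bump leqNgt lt_kn.
Qed.

Lemma vertices_first_face n (g : G ^ n.+1) :
  map (fun x => g ord0 * x)%g (vertices (first_face g)) =
  mkseq (partial_product (nth 1%g (codom g)) \o bump 0) n.+1.
Proof.
rewrite verticesE -map_comp; apply/eq_in_map => i; rewrite mem_iota /= => lt_in.
rewrite /bump leq0n /partial_product [RHS]big_nat_recl //.
rewrite (nth_codom_ffun _ ord0); congr (_ * _)%g.
apply: eq_big_nat => k /andP[_ lt_ki].
have lt_kn : (k < n)%N by lia.
rewrite (nth_codom_ffun _ (Ordinal lt_kn)) ffunE.
by rewrite -nth_codom_ffun.
Qed.

(** Multiplying two neighbours skips one partial product. *)
Lemma vertices_inner_face n (j : 'I_n) (g : G ^ n.+1) :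
  vertices (inner_face j g) =
  mkseq (partial_product (nth 1%g (codom g)) \o bump j.+1) n.+1.
Proof.
rewrite verticesE; apply/eq_in_map => i; rewrite mem_iota /= => lt_in.
rewrite /bump /partial_product; elim: i lt_in => [|i IH] lt_in.
  by rewrite !big_nil.
rewrite big_nat_recr //= IH ?(ltnW lt_in) //.
have lt_i : (i < n)%N by lia.
rewrite (nth_codom_ffun _ (Ordinal lt_i)) ffunE.
rewrite -!nth_codom_ffun /= /bump (leqNgt n i) lt_i add0n ltnS -val_eqE /=.
case: (ltngtP i j) => ij /=.
- by rewrite !add0n [in RHS]big_nat_recr.
- by rewrite !add1n [in RHS]big_nat_recr.
- by rewrite !add1n !add0n !(@big_nat_recr _ _ _ i.+1) // !big_nat_recr //= mulgA.
Qed.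

(** The inner and last faces of a bar simplex delete a vertex of
    (1, g1, g1 g2, ...).  Deleting the vertex 1 gives the first face only up to
    the translation by g1; this is where invariance is used. *)
Lemma coboundary_inhomogeneous F n : translation_invariant F ->
  coboundary (inhomogeneous F n) = inhomogeneous (sdiff F) n.+1.
Proof.
move=> Fi; apply/funext => g; rewrite /coboundary /inhomogeneous sdiff_sum.
rewrite [in RHS]size_vertices big_ord_recl big_ord_recr expr0 mul1r -addrA.
rewrite [vertices g]verticesE.
congr (_ + (_ + _)).
- by rewrite delete_mkseq // -vertices_first_face -/(translate _ _ _) Fi.
- apply: eq_bigr => j _; rewrite vertices_inner_face delete_mkseq ?lift0 //=.
  by rewrite !ltnS ltnW.
- by rewrite lift0 delete_mkseq // vertices_last_face.
Qed.

Lemma sdiff_homogeneous n (phi : C n) :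
  sdiff (homogeneous phi) = homogeneous (coboundary phi).
Proof.
apply: (@invariant_inj n.+1); try exact: homogeneous_invariant;
  try exact: homogeneous_size.
- by move=> a; rewrite -sdiff_translate homogeneous_invariant.
- by move=> s; apply: sdiff_size; apply: homogeneous_size.
- rewrite -coboundary_inhomogeneous ?homogeneousK //.
  exact: homogeneous_invariant.
Qed.

End Homogenization.

Arguments inhomogeneous {R G} F n _.

(** * The induced map on cohomology *)

Section InclusionIso.
Variables (R : realType) (G : groupType).
Variable P : forall n, submodClosed (@cochain R G n).
Variables (n : nat).
Local Notation C := (@cochain R G).

Lemma cocycle_coboundary0 (Q : forall m, submodClosed (C m)) (z : cocycle Q n) :
  coboundary (z : C n) = 0.
Proof. by case: z => z /= /andP[_ /eqP]. Qed.

Lemma cocycle_in (Q : forall m, submodClosed (C m)) (z : cocycle Q n) :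
  (z : C n) \in Q n.
Proof. by case: z => z /= /andP[]. Qed.

Lemma all_cocycle_subproof (z : cocycle P n) :
  is_cocycle (@all_cochains R G) (z : C n).
Proof. by rewrite /is_cocycle /= cocycle_coboundary0 eqxx. Qed.

Definition forget_growth (z : cocycle P n) : cocycle (@all_cochains R G) n :=
  Cocycle (all_cocycle_subproof z).

Lemma cohomology_class_eq (Q : forall m, submodClosed (C m)) (z w : cocycle Q n) :
  cohomology_class z = cohomology_class w <->
  is_coboundary Q ((z : C n) - (w : C n)).
Proof.
rewrite /cohomology_class; split.
- by move/eqP; rewrite qclass_eq => /asboolP.
- by move=> zw; apply/eqP; rewrite qclass_eq; apply/asboolP.
Qed.

Lemma cohomology_classP (Q : forall m, submodClosed (C m)) (q : cohomology Q n) :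
  exists z : cocycle Q n, cohomology_class z = q.
Proof. by exists (repr (q : Quotient.quot _)); apply: qclass_repr. Qed.

Lemma is_coboundary_all (phi : C n) :
  is_coboundary P phi -> is_coboundary (@all_cochains R G) phi.
Proof. by case: n phi => [|m] phi //= [psi _ ->]; exists psi. Qed.

(** Surjectivity and injectivity on cohomology, in terms of cochains. *)
Lemma inclusion_isoP :
  (forall phi : C n, coboundary phi = 0 ->
     exists2 psi, psi \in P n /\ coboundary psi = 0 &
       is_coboundary (@all_cochains R G) (phi - psi)) ->
  (forall phi : C n, phi \in P n -> coboundary phi = 0 ->
     is_coboundary (@all_cochains R G) phi -> is_coboundary P phi) ->
  inclusion_iso P n.
Proof.
move=> surj inj.
pose lift (q : cohomology P n) := sval (cid (cohomology_classP q)).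
have liftK q : cohomology_class (lift q) = q by rewrite /lift; case: cid.
pose Phi (q : cohomology P n) : cohomology (@all_cochains R G) n :=
  cohomology_class (forget_growth (lift q)).
have PhiE (z : cocycle P n) (w : cocycle (@all_cochains R G) n) :
    z = w :> C n -> Phi (cohomology_class z) = cohomology_class w.
  move=> zw; apply/cohomology_class_eq; rewrite -zw; apply: is_coboundary_all.
  by apply/cohomology_class_eq; rewrite liftK.
have Phi_linear : linear Phi.
  move=> a p q; rewrite -(liftK p) -(liftK q).
  rewrite (PhiE (lift p) (forget_growth (lift p))) //.
  rewrite (PhiE (lift q) (forget_growth (lift q))) //.
  by rewrite -!(linearP (qclass _)); apply: PhiE.
pose PhiL := HB.pack_for {linear cohomology P n -> cohomology (@all_cochains R G) n}
  Phi (GRing.isLinear.Build _ _ _ _ Phi Phi_linear).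
exists PhiL; split; last exact: PhiE.
have inv_ex (q : cohomology (@all_cochains R G) n) : exists p, Phi p = q.
  have [w <-] := cohomology_classP q.
  have [psi [psiP psi0] psi_w] := surj _ (cocycle_coboundary0 w).
  have zP : is_cocycle P psi by rewrite /is_cocycle psiP psi0 eqxx.
  exists (cohomology_class (Cocycle zP)).
  rewrite (PhiE _ (forget_growth (Cocycle zP))) //.
  by apply/esym/cohomology_class_eq.
have Phi_inj : injective Phi.
  move=> p q; rewrite -(liftK p) -(liftK q).
  rewrite (PhiE (lift p) (forget_growth (lift p))) //.
  rewrite (PhiE (lift q) (forget_growth (lift q))) //.
  move/cohomology_class_eq => pq; apply/cohomology_class_eq; apply: inj pq.
    rewrite -scaleN1r rpredD ?rpredZ //.
      exact: (cocycle_in (lift p)).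
    exact: (cocycle_in (lift q)).
  rewrite raddfB /= (cocycle_coboundary0 (lift p)).
  by rewrite (cocycle_coboundary0 (lift q)) subrr.
exists (fun q => sval (cid (inv_ex q))) => [p | q]; last by case: cid.
by apply: Phi_inj; case: cid.
Qed.

(** A cocycle phi differs from u phi, which has controlled growth, by the
    coboundary of h phi.  If phi = d psi has controlled growth, it is the
    coboundary of u psi + h phi, which has controlled growth. *)
Lemma inclusion_iso_homotopy
    (u : forall m, C m -> C m) (h : forall m, C m.+1 -> C m) :
  (forall m phi, coboundary (u m phi) = u m.+1 (coboundary phi)) ->
  (forall m, h m 0 = 0) ->
  (forall phi : C 0, phi - u _ phi = h _ (coboundary phi)) ->
  (forall m (phi : C m.+1),
     phi - u _ phi = h _ (coboundary phi) + coboundary (h _ phi)) ->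
  (forall m phi, u m phi \in P m) ->
  (forall m phi, phi \in P m.+1 -> h m phi \in P m) ->
  (forall m, u m 0 = 0) ->
  inclusion_iso P n.
Proof.
move=> uD h0 H0 H uP hP u0; apply: inclusion_isoP => phi.
- move=> phi0; exists (u _ phi); first by split; rewrite ?uP // uD phi0 u0.
  case: n phi phi0 => [|m] phi phi0; first by rewrite H0 phi0 h0.
  by exists (h _ phi) => //; rewrite H phi0 h0 add0r.
- case: n phi => [|m] phi phiP phi0 //= [psi _ phiE].
  exists (u _ psi + h _ phi); first by apply: rpredD; [apply: uP | apply: hP].
  rewrite raddfD /= uD -phiE -[phi in LHS](subrK (u _ phi)).
  by rewrite H phi0 h0 add0r addrC.
Qed.
End InclusionIso.

(** * Growth classes and estimates *)

Section Growth.
Variable R : realType.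

(** Orders of growth of functions of the total length.  The closure properties
    reflect the operations in the estimates: numbers of simplices are added and
    multiplied, and lengths are distorted at most linearly. *)
Record growth_class := GrowthClass {
  grows :> (nat -> R) -> Prop;
  growsC : forall c, 0 <= c -> grows (fun=> c);
  growsD : forall v w, (forall L, 0 <= v L) -> (forall L, 0 <= w L) ->
    grows v -> grows w -> grows (fun L => v L + w L);
  growsM : forall v w, (forall L, 0 <= v L) -> (forall L, 0 <= w L) ->
    grows v -> grows w -> grows (fun L => v L * w L);
  grows_affine : forall w c, (forall L, 0 <= w L) ->
    grows w -> grows (fun L => w (c * L.+1)%N) }.

Variable W : growth_class.

(** By monotonicity, estimates for the exact size of a simplex also hold for
    upper bounds of its size. *)
Definition gauge (w : nat -> R) : Prop :=
  [/\ forall L, 0 <= w L, {homo w : m n / (m <= n)%N >-> m <= n} & W w].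

Lemma gaugeC c : 0 <= c -> gauge (fun=> c).
Proof. by move=> c0; split=> //; apply: growsC. Qed.

Lemma gaugeD v w : gauge v -> gauge w -> gauge (fun L => v L + w L).
Proof.
move=> [v0 vm vW] [w0 wm wW]; split=> [L|m n mn|]; last exact: growsD.
  exact: addr_ge0.
by apply: lerD; [apply: vm | apply: wm].
Qed.

Lemma gaugeM v w : gauge v -> gauge w -> gauge (fun L => v L * w L).
Proof.
move=> [v0 vm vW] [w0 wm wW]; split=> [L|m n mn|]; last exact: growsM.
  exact: mulr_ge0.
by apply: ler_pM => //; [apply: vm | apply: wm].
Qed.

Lemma gauge_affine w c : gauge w -> gauge (fun L => w (c * L.+1)%N).
Proof.
move=> [w0 wm wW]; split=> // [m n mn|]; last exact: (@grows_affine W w c).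
by apply: wm; rewrite leq_mul2l ltnS mn orbT.
Qed.

End Growth.

Section PrismBound.
Variables (R : realType) (T : eqType) (f f' : T -> T).
Variables (e e' : rel T) (p p' : pred T).
Hypothesis e_f : forall x y, e x y -> e' (f x) (f y).
Hypothesis e_f' : forall x y, e x y -> e' (f' x) (f' y).
Hypothesis e_ff' : forall x, e' (f x) (f' x).
Hypothesis p_f : forall x, p x -> p' (f x).
Hypothesis p_f' : forall x, p x -> p' (f' x).

Let prism_bound_path (M : R) s x (phi : seq T -> R) :
  (forall t, size t = (size s).+1 -> path e' (f x) t -> all p' t ->
     `|phi (f x :: t)| <= M) ->
  path e x s -> p x -> all p s ->
  `|prism f f' phi (x :: s)| <= (size s).+1%:R * M.
Proof.
have path_f' y t : path e y t -> path e' (f' y) (map f' t).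
  by rewrite path_map; apply: sub_path => ? ?; apply: e_f'.
have all_f' t : all p t -> all p' (map f' t).
  by rewrite all_map; apply: sub_all => ?; apply: p_f'.
elim: s x phi => [|y s IH] x phi phiM.
  move=> _ px _; rewrite /= subr0 mul1r; apply: phiM => //=.
    by rewrite e_ff'.
  by rewrite p_f'.
move=> /[dup] xs /= /andP[xy ys] px /[dup] aps /= /andP[py ps].
apply: le_trans (ler_normB _ _) _; rewrite -natr1 mulrDl mul1r addrC.
apply: lerD.
  apply: (IH y (fun t => phi (f x :: t))) => // t st yt at_.
  by apply: phiM => /=; rewrite ?st ?e_f ?p_f.
apply: phiM => /=; first by rewrite size_map.
  by apply/andP; split; [apply: e_ff' | apply: (path_f' x (y :: s) xs)].
by rewrite !p_f' // all_f'.
Qed.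

Lemma prism_bound (M : R) s (phi : seq T -> R) :
  (forall t, size t = (size s).+1 -> sorted e' t -> all p' t -> `|phi t| <= M) ->
  sorted e s -> all p s -> `|prism f f' phi s| <= (size s)%:R * M.
Proof.
case: s => [|x s]; first by rewrite /= normr0 mul0r.
move=> phiM xs /= /andP[px ps]; apply: prism_bound_path => // t st xt pt.
by apply: phiM => //=; rewrite ?st ?p_f.
Qed.

End PrismBound.

Section Estimates.
Variables (R : realType) (W : growth_class R) (G : groupType) (ell : G -> nat).
Hypothesis ell1 : ell 1%g = 0%N.
Hypothesis ellM : forall x y, (ell (x * y)%g <= ell x + ell y)%N.
Variables (f : nat -> G -> G) (stab : G -> nat) (c e : nat) (J : nat -> R).
Hypothesis f0 : forall x, f 0%N x = 1%g.
Hypothesis f_lip : forall n x y,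
  (word_dist ell (f n x) (f n y) <= c * (word_dist ell x y).+1)%N.
Hypothesis f_ell : forall n x, (ell (f n x) <= c * (ell x).+1)%N.
Hypothesis f_step : forall n x, (word_dist ell (f n x) (f n.+1 x) <= e)%N.
Hypothesis J_gauge : gauge W J.
Hypothesis f_jumps : forall x n,
  \sum_(0 <= k < n) (f k x != f k.+1 x)%:R <= J (ell x).
Implicit Types (phi psi : seq G -> R) (s t l : seq G).
Local Notation fill := (fill f stab).

(** Only distances of consecutive vertices of a simplex are controlled: the
    combing and the prisms preserve such control, no faces are taken in the
    constructions of [u] and [h], and it suffices for finiteness up to
    translation. *)
Definition near D : rel G := fun x y => (word_dist ell x y <= D)%N.
Definition in_ball r : pred G := fun x => (ell x <= r)%N.

Lemma near_refl D x : near D x x.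
Proof. by rewrite /near /word_dist mulVg ell1. Qed.

Lemma sorted_nseq1 D n : sorted (near D) (nseq n 1%g).
Proof. by case: n => //= n; elim: n => //= n ->; rewrite near_refl. Qed.

Lemma near_translate D a x y : near D (a * x)%g (a * y)%g = near D x y.
Proof. by rewrite /near /word_dist invgM -mulgA mulKg. Qed.

(** If no vertex of s jumps at time n then the step vanishes; otherwise the sum
    over the vertices is at least 1, and each of the two prisms consists of
    size s simplices. *)
Lemma step_bound n phi s D r M :
  (forall t, size t = (size s).+1 -> sorted (near (c * D.+1 + e)) t ->
     all (in_ball (c * r.+1)) t -> `|phi t| <= M) ->
  sorted (near D) s -> all (in_ball r) s -> 0 <= M ->
  `|step f n phi s| <=
    (\sum_(x <- s) (f n x != f n.+1 x)%:R) * (2 * (size s)%:R * M).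
Proof.
move=> phiM sD sr M0.
have [/allP fs|] := boolP (all (fun x => f n x == f n.+1 x) s).
  rewrite step_fixed ?normr0 => [|x /fs /eqP //].
  by rewrite !mulr_ge0 ?sumr_ge0.
rewrite -has_predC => /hasP[x xs /= fx].
have lip m y z : near D y z -> near (c * D.+1 + e) (f m y) (f m z).
  move=> yz; apply: leq_trans (f_lip _ _ _) _; apply: leq_trans (leq_addr _ _).
  by rewrite leq_mul2l ltnS [(word_dist _ _ _ <= _)%N]yz orbT.
have ball m y : in_ball r y -> in_ball (c * r.+1) (f m y).
  move=> yr; apply: leq_trans (f_ell _ _) _.
  by rewrite leq_mul2l ltnS [(ell _ <= _)%N]yr orbT.
have pb m : (forall x, near (c * D.+1 + e) (f n x) (f m x)) ->
    `|prism (f n) (f m) phi s| <= (size s)%:R * M.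
  move=> near_m.
  exact: (prism_bound (lip n) (lip m) near_m (ball n) (ball m) phiM).
have le1 : 1 <= \sum_(x <- s) (f n x != f n.+1 x)%:R :> R.
  by rewrite (big_rem x) //= fx lerDl sumr_ge0.
apply: (@le_trans _ _ (2 * (size s)%:R * M)); last first.
  by rewrite ler_peMl // !mulr_ge0.
rewrite -mulrA mulr_natl mulr2n; apply: le_trans (ler_normB _ _) _.
apply: lerD; apply: pb => y; last exact: near_refl.
by apply: leq_trans (f_step _ _) _; apply: leq_addl.
Qed.

(** A step at time n contributes only if a vertex jumps, so the number of
    simplices in the filling is at most 2 (size s) times the total number of
    jumps of the vertices, plus one for the cone. *)
Lemma fill_bound phi s D r M :
  (forall t, size t = (size s).+1 -> sorted (near (c * D.+1 + e)) t ->
     all (in_ball (c * r.+1)) t -> `|phi t| <= M) ->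
  sorted (near D) s -> all (in_ball r) s ->
  `|fill phi s| <= (1 + 2 * (size s)%:R * ((size s)%:R * J r)) * M.
Proof.
move=> phiM sD sr; have [J0 J_mono _] := J_gauge.
have apexM : `|phi (1%g :: map (f 0) s)| <= M.
  have -> : map (f 0) s = nseq (size s) 1%g.
    by elim: {phiM sD sr} s => //= x s ->; rewrite f0.
  rewrite -[1%g :: _]/(nseq (size s).+1 1%g); apply: phiM; rewrite ?size_nseq //.
    exact: sorted_nseq1.
  by rewrite all_nseq /in_ball ell1 orbT.
have M0 : 0 <= M by apply: le_trans apexM.
have H n : `|fill_upto f n phi s| <= M +
  (\sum_(0 <= k < n) \sum_(x <- s) (f k x != f k.+1 x)%:R) * (2 * (size s)%:R * M).
  elim: n => [|n IH]; first by rewrite big_nil mul0r addr0.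
  rewrite big_nat_recr // mulrDl [leRHS]addrA.
  apply: le_trans (ler_normD (fill_upto f n phi s) (step f n phi s)) _.
  by apply: lerD IH _; apply: step_bound phiM _ _ _.
apply: le_trans (H _) _; rewrite [leRHS]mulrDl mul1r lerD2l.
rewrite exchange_big /=.
rewrite [leRHS](_ : _ = (size s)%:R * J r * (2 * (size s)%:R * M)); last by ring.
apply: ler_wpM2r; first by rewrite !mulr_ge0.
apply: (@le_trans _ _ (\sum_(x <- s) J r)); last first.
  by rewrite big_const_seq count_predT iter_addr addr0 mulr_natl.
rewrite big_seq [leRHS]big_seq; apply: ler_sum => x xs.
by apply: le_trans (f_jumps _ _) _; apply: J_mono; apply: (allP sr).
Qed.

Definition total_length l := (\sum_(a <- l) ell a)%N.

Lemma total_length_cons a l : total_length (a :: l) = (ell a + total_length l)%N.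
Proof. exact: big_cons. Qed.

Lemma translate_in_ball a r r' s : (ell a + r <= r')%N -> all (in_ball r) s ->
  all (in_ball r') (map (fun x => a * x)%g s).
Proof.
move=> ar; rewrite all_map; apply: sub_all => x xr /=.
by apply: leq_trans (ellM _ _) _; apply: leq_trans ar; rewrite leq_add2l.
Qed.

Lemma sorted_translate D a s :
  sorted (near D) (map (fun x => a * x)%g s) = sorted (near D) s.
Proof.
case: s => //= x s; rewrite path_map; apply: eq_path => ? ?.
exact: near_translate.
Qed.

Lemma products_in_ball b l :
  all (in_ball (ell b + total_length l)) (products b l).
Proof.
elim: l b => //= a l IH b; rewrite total_length_cons addnA; apply/andP; split.
  by apply: leq_trans (ellM _ _) (leq_addr _ _).
apply: sub_all (IH _) => x /leq_trans; apply.
by rewrite leq_add2r ellM.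
Qed.

(** The constant D bounding consecutive distances depends on n only.  In
    contrast, the vertices may move away from 1 linearly in the total length, and
    so the number of their jumps is bounded by the gauge J at a linear function of
    that length. *)
Lemma bar_fill_bound n : exists D c' N, gauge W N /\ forall phi l M,
  size l = n ->
  (forall t, size t = n.+1 -> sorted (near D) t ->
     all (in_ball (c' * (total_length l).+1)) t -> `|phi t| <= M) ->
  `|bar_fill fill phi l| <= N (total_length l) * M.
Proof.
elim: n => [|n [D [c' [N [NW IH]]]]].
  exists (c * 1 + e)%N, c, (fun=> 1); split; first exact: gaugeC.
  move=> phi [|//] M _ phiM /=; rewrite mul1r.
  have := @fill_bound phi [::] 0 0 M.
  rewrite mulr0 mul0r addr0 mul1r; apply=> //.
  by rewrite /total_length big_nil in phiM.
exists (c * D.+1 + e)%N, (c * c'.+2)%N.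
exists (fun L => N L * (1 + 2 * n.+1%:R * (n.+1%:R * J (c'.+1 * L.+1)%N))); split.
  apply: (gaugeM NW); apply: gaugeD; first exact: gaugeC.
  apply: gaugeM; first by apply: gaugeC; rewrite mulr_ge0.
  by apply: gaugeM; [apply: gaugeC | apply: gauge_affine].
move=> phi [//|a l] M [sl] phiM; rewrite -mulrA /=.
have [N0 N_mono _] := NW; have [J0 _ _] := J_gauge.
have La : (total_length l <= total_length (a :: l))%N.
  by rewrite total_length_cons leq_addl.
set K := (1 + _) * M.
have K_bound :
    `|bar_fill fill (translate a (fill phi)) l| <= N (total_length l) * K.
  apply: IH => // t st tD tr; rewrite /translate.
  rewrite /K -st -(size_map (fun x => a * x)%g t).
  apply: (@fill_bound _ _ D); last 1 first.
  - apply: translate_in_ball tr; rewrite total_length_cons; nia.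
  - move=> u; rewrite size_map st => su uD ur; apply: phiM => //.
    apply: sub_all ur => x /leq_trans; apply; nia.
  - by rewrite sorted_translate.
apply: le_trans K_bound _; apply: ler_wpM2r; last exact: N_mono.
have M0 : 0 <= M.
  apply: le_trans (phiM (nseq n.+2 1%g) _ _ _) => //; rewrite ?size_nseq //.
    exact: sorted_nseq1.
  by rewrite all_nseq /in_ball ell1 orbT.
by rewrite /K mulr_ge0 // addr_ge0 // !mulr_ge0.
Qed.

(** Consecutive distances in h [a1|...|an] are not bounded, because the cones
    join 1 to vertices far away; the distance of all vertices from 1 is still linear
    in the total length. *)
Lemma bar_homotopy_bound n : exists c' N, gauge W N /\ forall phi l M,
  size l = n ->
  (forall t, size t = n.+2 -> all (in_ball (c' * (total_length l).+1)) t ->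
     `|phi t| <= M) ->
  `|bar_homotopy fill phi l| <= N (total_length l) * M.
Proof.
elim: n => [|n [c' [N [NW IH]]]].
  have [D [c1 [N1 [NW1 H1]]]] := bar_fill_bound 0.
  exists c1.+1, (fun L => 1 + N1 L); split.
    by apply: gaugeD => //; apply: gaugeC.
  move=> phi l M sl phiM; rewrite bar_homotopyE; case: l sl phiM => // _ phiM.
  rewrite subr0 mulrDl mul1r; apply: le_trans (ler_normB _ _) _; apply: lerD.
    by apply: phiM => //=; rewrite /in_ball ell1.
  apply: H1 => // t st _ tr; apply: phiM; rewrite /= ?st //.
  rewrite {1}/in_ball ell1; apply: sub_all tr => x /leq_trans; apply.
  by rewrite leq_mul2r leqnSn orbT.
have [D [c1 [N1 [NW1 H1]]]] := bar_fill_bound n.+1.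
exists (c1 + c').+1, (fun L => 1 + N1 L + N L); split.
  by apply: gaugeD => //; apply: gaugeD => //; apply: gaugeC.
move=> phi l M sl phiM; rewrite bar_homotopyE !mulrDl mul1r.
apply: le_trans (ler_normB _ _) _; apply: lerD.
  apply: le_trans (ler_normB _ _) _; apply: lerD.
    apply: phiM; first by rewrite /= size_scanl sl.
    rewrite /= {1 2}/in_ball ell1 /=.
    apply: sub_all (products_in_ball _ _) => x /leq_trans; apply.
    rewrite ell1; nia.
  apply: H1 => // t st _ tr; apply: phiM; rewrite /= ?st //.
  rewrite {1}/in_ball ell1; apply: sub_all tr => x /leq_trans; apply; nia.
have M0 : 0 <= M.
  apply: le_trans (phiM (nseq n.+3 1%g) _ _) => //; rewrite ?size_nseq //.
  by rewrite all_nseq /in_ball ell1 orbT.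
case: l sl phiM => // a l [sl] phiM.
have [N0 N_mono _] := NW.
apply: (@le_trans _ _ (N (total_length l) * M)); last first.
  by apply: ler_wpM2r => //; apply: N_mono; rewrite total_length_cons leq_addl.
apply: IH => // t st tr; apply: phiM; rewrite /= ?size_map ?st //.
rewrite {1}/in_ball ell1 /=; apply: translate_in_ball tr.
rewrite total_length_cons; nia.
Qed.

End Estimates.

(** * Word length *)

Section WordLength.
Variables (G : groupType) (S : seq G) (genS : generates S).
Local Notation ell := (word_length genS).

Lemma word_lengthP g : is_word S g (ell g).
Proof. by rewrite /word_length; case: ex_minnP => n /asboolP. Qed.

Lemma word_length_le g n : is_word S g n -> (ell g <= n)%N.
Proof.
by move=> gn; rewrite /word_length; case: ex_minnP => m _; apply; apply/asboolP.
Qed.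

Lemma word_length1 : ell 1%g = 0%N.
Proof.
by apply/eqP; rewrite -leqn0; apply: word_length_le; exists [::]; rewrite big_nil.
Qed.

Lemma word_lengthM x y : (ell (x * y)%g <= ell x + ell y)%N.
Proof.
have [[v [sv vS vx]] [w [sw wS wy]]] := (word_lengthP x, word_lengthP y).
apply: word_length_le; exists (v ++ w); rewrite size_cat sv sw big_cat vx wy.
by split=> // s; rewrite mem_cat => /orP[/vS | /wS].
Qed.

Lemma word_lengthV_le x : (ell x^-1%g <= ell x)%N.
Proof.
have [w [sw wS wx]] := word_lengthP x; apply: word_length_le.
exists (rev (map (fun s => s^-1)%g w)); split; first by rewrite size_rev size_map.
  move=> s; rewrite mem_rev => /mapP[t /wS tS ->]; rewrite invgK.
  by case: tS; [right | left].
rewrite -[in RHS]wx; elim: w {sw wS wx} => [|s w IH].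
  by rewrite !big_nil invg1.
by rewrite [in RHS]big_cons invgM /= rev_cons -cats1 big_cat big_seq1 IH.
Qed.

Lemma word_length_ball_finite r :
  exists B : seq G, forall g, (ell g <= r)%N -> g \in B.
Proof.
suff [B HB] : exists B : seq G, forall g n, (n <= r)%N -> is_word S g n -> g \in B.
  by exists B => g gr; apply: HB gr (word_lengthP g).
elim: r => [|r [B HB]].
  exists [:: 1%g] => g [|//] _ [w [/size0nil -> _ <-]].
  by rewrite big_nil mem_head.
pose S' := S ++ map (fun s => s^-1)%g S.
exists (B ++ [seq (s * b)%g | s <- S', b <- B]) => g [|n] nr gw.
  by rewrite mem_cat (HB g 0%N).
case: gw => -[|s w] [] // [sw] wS <-; rewrite mem_cat big_cons; apply/orP; right.
apply: allpairs_f.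
  rewrite mem_cat; have [sS|sS] := wS s (mem_head _ _); rewrite ?sS //.
  by rewrite -[s]invgK map_f ?orbT.
apply: HB nr _; exists w; split=> // t tw; apply: wS.
by rewrite inE tw orbT.
Qed.

End WordLength.

(** * From a combing to the isomorphism *)

Section Assembly.
Variables (R : realType) (W : growth_class R) (G : groupType) (ell : G -> nat).
Hypothesis ell1 : ell 1%g = 0%N.
Hypothesis ellM : forall x y, (ell (x * y)%g <= ell x + ell y)%N.
Hypothesis ellV : forall x, (ell x^-1%g <= ell x)%N.
Hypothesis ball_finite : forall r, exists B : seq G,
  forall g, (ell g <= r)%N -> g \in B.
Local Notation C := (@cochain R G).

(** There are finitely many lists of given length with entries in B. *)
Lemma finite_bound (B : seq G) n (F : seq G -> R) :
  exists M, forall s, size s = n -> all (mem B) s -> `|F s| <= M.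
Proof.
elim: n F => [|n IH] F; first by exists `|F [::]| => s /size0nil ->.
suff [M HM] : exists M, forall x s, x \in B -> size s = n -> all (mem B) s ->
    `|F (x :: s)| <= M.
  by exists M => -[//|x s] [sn] /= /andP[xB sB]; apply: HM.
elim: {1}B => [|b B' [M' HM']]; first by exists 0.
have [M HM] := IH (fun s => F (b :: s)).
exists (Num.max M M') => x s; rewrite inE le_max => /predU1P[-> | xB] sn sB.
  by rewrite HM.
by rewrite HM' // orbT.
Qed.

Lemma quotients_in_ball r x s : in_ball ell r x -> all (in_ball ell r) s ->
  all (in_ball ell (r + r)) (quotients x s).
Proof.
elim: s x => //= y s IH x xr /andP[yr sr]; rewrite IH // andbT.
apply: leq_trans (ellM _ _) _; apply: leq_add => //.
exact: leq_trans (ellV _) _.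
Qed.

(** Up to translation there are finitely many simplices whose consecutive
    vertices have bounded distance, so any cochain is bounded on them. *)
Lemma homogeneous_near_bound n (phi : C n) D : exists M, forall s,
  size s = n.+1 -> sorted (near ell D) s -> `|homogeneous phi s| <= M.
Proof.
have [B BD] := ball_finite D.
have [M HM] := @finite_bound B n (fun l => phi [ffun i : 'I_n => nth 1%g l i]).
exists M => -[//|x s] [sn] /=; rewrite sn eqxx => sD; apply: HM.
  by rewrite size_pairmap.
elim: s x sD {sn} => //= y s IH x /andP[xy sD]; rewrite IH // andbT.
exact: BD.
Qed.

Lemma homogeneous_gauge_bound n (phi : C n) w r s : gauge W w ->
  (forall g, `|phi g| <= w (\sum_(i < n) ell (g i))%N) ->
  size s = n.+1 -> all (in_ball ell r) s ->
  `|homogeneous phi s| <= w (n * (r + r))%N.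
Proof.
move=> [_ w_mono _] phiw; case: s => [//|x s] [sn] /= /andP[xr sr].
rewrite sn eqxx; apply: le_trans (phiw _) _; apply: w_mono.
rewrite -[n in leqRHS]card_ord -sum_nat_const; apply: leq_sum => i _.
rewrite ffunE; apply: (allP (quotients_in_ball xr sr)).
by rewrite mem_nth // size_pairmap sn.
Qed.

Variables (f : nat -> G -> G) (J : nat -> R).
Hypothesis f_combing : is_combing R ell f.
Hypothesis J_gauge : gauge W J.
Hypothesis f_jumps : forall x, (jumps f x)%:R <= J (ell x).

(** The sequence f_k x is eventually constant, so the set of its jumps is finite
    and the cardinal in the definition of jumps is a genuine one. *)
Lemma sum_jumps_le x n : (forall m, (n <= m)%N -> f m x = x) -> forall m,
  (\sum_(0 <= k < m) (f k x != f k.+1 x) <= jumps f x)%N.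
Proof.
move=> fx m; set A := [set k : nat | f k x <> f k.+1 x]%classic.
have A_fin : finite_set A.
  apply: sub_finite_set (finite_II n) => k /=; rewrite /A /=.
  by case: (ltnP k n) => // nk; rewrite !fx // leqW.
rewrite (_ : (\sum_(_ <= k < _) _)%N =
  count (fun k => f k x != f k.+1 x) (index_iota 0 m)); last first.
  by rewrite -sum1_count [RHS]big_mkcond; apply: eq_bigr => k _; case: eqP.
rewrite -size_filter /jumps.
apply: uniq_leq_size => [|k]; first by rewrite filter_uniq ?iota_uniq.
by rewrite mem_filter in_fset_set // => /andP[/eqP kf _]; rewrite inE.
Qed.

(** The Lipschitz constant is replaced by an integer.  Distances from 1 also grow
    at most linearly, because f_n 1 takes finitely many values. *)
Lemma combing_data : exists stab c e,
  [/\ forall x n, (stab x <= n)%N -> f n x = x,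
      forall n x y,
        (word_dist ell (f n x) (f n y) <= c * (word_dist ell x y).+1)%N,
      forall n x, (ell (f n x) <= c * (ell x).+1)%N,
      forall n x, (word_dist ell (f n x) (f n.+1 x) <= e)%N &
      forall x n, \sum_(0 <= k < n) (f k x != f k.+1 x)%:R <= J (ell x)].
Proof.
have [f0 f_stab [K [K0 f_lip]] [e f_step]] := f_combing.
have [stab stabP] := choice f_stab.
pose c := Num.bound K.
have f_c n x y : (word_dist ell (f n x) (f n y) <= c * (word_dist ell x y).+1)%N.
  rewrite -(ler_nat R) natrM; apply: le_trans (f_lip _ _ _) _.
  by rewrite addn1 ler_wpM2r // ltW // archi_boundP // ltW.
pose B := (\max_(k < stab 1%g) ell (f k 1%g))%N.
have fB n : (ell (f n 1%g) <= B)%N.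
  case: (ltnP n (stab 1%g)) => [lt_n | /stabP->]; last by rewrite ell1.
  exact: (leq_bigmax (Ordinal lt_n)).
exists stab, (B + c)%N, e; split=> //.
- by move=> n x y; apply: leq_trans (f_c _ _ _) _; rewrite leq_mul2r leq_addl orbT.
- move=> n x; rewrite -[f n x](mulVKg (f n 1%g)); apply: leq_trans (ellM _ _) _.
  have := f_c n 1%g x; rewrite /word_dist invg1 mul1g => fx.
  by rewrite mulnDl leq_add // (leq_trans (fB n)) // leq_pmulr.
- move=> x n; apply: le_trans (f_jumps x); rewrite -natr_sum ler_nat.
  exact: sum_jumps_le (@stabP x) n.
Qed.

Variable P : forall n, submodClosed (C n).
Hypothesis P_gauge : forall n (phi : C n), phi \in P n <-> exists w,
  gauge W w /\ forall g, `|phi g| <= w (\sum_(i < n) ell (g i))%N.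

(** The operators are the transposes of [u] and [h] in inhomogeneous form.  The
    number of simplices is a gauge by [bar_fill_bound] and [bar_homotopy_bound];
    it is multiplied by a constant in the case of [u], and by a gauge at a linear
    function of the total length in the case of [h]. *)
Lemma gauge_inclusion_iso n : inclusion_iso P n.
Proof.
have f0 : forall x, f 0%N x = 1%g by case: f_combing.
have [stab [c [e [stabP f_lip f_ell f_step J_sum]]]] := combing_data.
have fB := @fillB R G f stab; have fD := @fill_sdiff R G f stab f0 stabP.
pose fill := @fill R G f stab.
pose u m (phi : C m) : C m := inhomogeneous (small fill (homogeneous phi)) m.
pose h m (phi : C m.+1) : C m := inhomogeneous (homotopy fill (homogeneous phi)) m.
have small_inv m (phi : C m) : translation_invariant (small fill (homogeneous phi)).
  by move=> a; rewrite -small_translate homogeneous_invariant.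
have homotopy_inv m (phi : C m) :
    translation_invariant (homotopy fill (homogeneous phi)).
  by move=> a; rewrite -homotopy_translate homogeneous_invariant.
have total_codom m (g : G ^ m) :
    total_length ell (codom g) = (\sum_(i < m) ell (g i))%N.
  by rewrite /total_length big_map big_enum.
have codom_size m (g : G ^ m) : size (codom g) = m by rewrite size_codom card_ord.
have uE m (phi : C m) g : u m phi g = bar_fill fill (homogeneous phi) (codom g).
  by rewrite /u /inhomogeneous /vertices /= translate1 productsK.
have hE m (phi : C m.+1) g :
    h m phi g = bar_homotopy fill (homogeneous phi) (codom g).
  by rewrite /h /inhomogeneous /vertices /= translate1 productsK.
have homogeneous0 m : @homogeneous R G m 0 = fun=> 0.
  by apply/funext => -[|x s] //=; case: eqP.
apply: (@inclusion_iso_homotopy R G P n u h).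
- move=> m phi; rewrite /u coboundary_inhomogeneous // -sdiff_homogeneous.
  apply: (congr1 (fun F => inhomogeneous F m.+1)).
  by apply/funext => s; rewrite small_sdiff.
- move=> m; apply/funext => g; rewrite /h /inhomogeneous homogeneous0.
  by have := homotopyB fB (fun=> 0) (fun=> 0) (vertices g); rewrite !subr0 subrr.
- move=> phi; rewrite -{1}(homogeneousK phi) /h -sdiff_homogeneous.
  apply/funext => g; apply: etrans (homotopyP fB fD _ (vertices g)) _.
  have /size0nil g0 := codom_size _ g.
  by rewrite {2}/vertices g0 /= subrr addr0.
- move=> m phi; rewrite coboundary_inhomogeneous // -{1}(homogeneousK phi) /h.
  rewrite -sdiff_homogeneous.
  by apply/funext => g; apply: (homotopyP fB fD _ (vertices g)).
- move=> m phi; apply/P_gauge.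
  have [D [c' [N [NW HN]]]] := 
    bar_fill_bound ell1 ellM stab f0 f_lip f_ell f_step J_gauge J_sum m.
  have [M HM] := homogeneous_near_bound phi D.
  exists (fun L => N L * `|M|); split.
    by apply: gaugeM => //; apply: gaugeC.
  move=> g; rewrite uE -total_codom; apply: HN => // t st tD _.
  by apply: le_trans (HM _ st tD) _; apply: ler_norm.
- move=> m phi /P_gauge[w [wW phiw]]; apply/P_gauge.
  have [c' [N [NW HN]]] := 
    bar_homotopy_bound ell1 ellM stab f0 f_lip f_ell f_step J_gauge J_sum m.
  exists (fun L => N L * w (m.+1 * (2 * c') * L.+1)%N); split.
    by apply: gaugeM => //; apply: gauge_affine.
  move=> g; rewrite hE -total_codom; apply: HN => // t st tr.
  rewrite (_ : _ * _.+1 = m.+1 * (c' * (total_length ell (codom g)).+1 +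
    c' * (total_length ell (codom g)).+1))%N; last by lia.
  exact: homogeneous_gauge_bound phiw st tr.
- move=> m; apply/funext => g; rewrite /u /inhomogeneous homogeneous0.
  by have := smallB fB (fun=> 0) (fun=> 0) (vertices g); rewrite !subr0 subrr.
Qed.

End Assembly.

(** * The three growth classes *)

Section GrowthClasses.
Variable R : realType.
Implicit Types (v w : nat -> R) (a b : R).

(** Iterated square roots suffice, since n <= 2 ^ n. *)
Lemma ex_root_gt1 n a : 1 < a -> exists2 b, 1 < b & b ^+ n <= a.
Proof.
move=> a1; suff [b b1 ba] : exists2 b, 1 < b & b ^+ (2 ^ n) <= a.
  exists b => //; apply: le_trans ba; apply: ler_weXn2l; first exact: ltW.
  exact/ltnW/ltn_expl.
elim: n => [|n [b b1 ba]]; first by exists a.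
exists (Num.sqrt b); first by rewrite -[ltLHS]sqrtr1 ltr_sqrt // (lt_trans ltr01).
by rewrite expnS exprM sqr_sqrtr // ltW // (lt_trans ltr01).
Qed.

Lemma exprn_mono a m n : 1 < a -> (m <= n)%N -> a ^+ m <= a ^+ n.
Proof. by move=> /ltW a1; apply: ler_weXn2l. Qed.

Lemma exprn_pos a n : 1 < a -> 0 < a ^+ n.
Proof. by move=> a1; rewrite exprn_gt0 // (lt_trans ltr01). Qed.

Definition poly_grows w : Prop :=
  exists k, exists2 C, 0 < C & forall L, w L <= C * L.+1%:R ^+ k.

Definition subexp_grows w : Prop := forall a, 1 < a ->
  exists2 C, 0 < C & forall L, w L <= C * a ^+ L.

Definition exp_grows w : Prop :=
  exists a C, [/\ 1 < a, 0 < C & forall L, w L <= C * a ^+ L].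

Lemma poly_growsC c : 0 <= c -> poly_grows (fun=> c).
Proof.
move=> c0; exists 0%N, (c + 1); first by rewrite ltr_wpDl.
by move=> L; rewrite mulr1 lerDl.
Qed.

Lemma poly_growsD v w : (forall L, 0 <= v L) -> (forall L, 0 <= w L) ->
  poly_grows v -> poly_grows w -> poly_grows (fun L => v L + w L).
Proof.
move=> _ _ [k [C C0 vC]] [l [D D0 wD]].
exists (maxn k l), (C + D) => [|L]; first exact: addr_gt0.
rewrite mulrDl; apply: lerD; [apply: le_trans (vC L) _ | apply: le_trans (wD L) _];
  by rewrite ler_pM2l // ler_weXn2l ?ler1n ?leq_maxl ?leq_maxr.
Qed.

Lemma poly_growsM v w : (forall L, 0 <= v L) -> (forall L, 0 <= w L) ->
  poly_grows v -> poly_grows w -> poly_grows (fun L => v L * w L).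
Proof.
move=> v0 w0 [k [C C0 vC]] [l [D D0 wD]].
exists (k + l)%N, (C * D) => [|L]; first exact: mulr_gt0.
by rewrite exprD mulrACA; apply: ler_pM.
Qed.

Lemma poly_grows_affine w c : (forall L, 0 <= w L) ->
  poly_grows w -> poly_grows (fun L => w (c * L.+1)%N).
Proof.
move=> _ [k [C C0 wC]]; exists k, (C * c.+1%:R ^+ k) => [|L].
  by rewrite mulr_gt0 ?exprn_gt0 ?ltr0n.
apply: le_trans (wC _) _; rewrite -mulrA ler_pM2l // -exprMn.
by rewrite -natrM lerXn2r ?nnegrE // ler_nat; nia.
Qed.

Lemma subexp_growsC c : 0 <= c -> subexp_grows (fun=> c).
Proof.
move=> c0 a a1; exists (c + 1) => [|L]; first by rewrite ltr_wpDl.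
rewrite -[leLHS]mulr1; apply: ler_pM => //; first by rewrite lerDl.
by rewrite -(expr0 a) exprn_mono.
Qed.

Lemma subexp_growsD v w : (forall L, 0 <= v L) -> (forall L, 0 <= w L) ->
  subexp_grows v -> subexp_grows w -> subexp_grows (fun L => v L + w L).
Proof.
move=> _ _ vS wS a a1; have [[C C0 vC] [D D0 wD]] := (vS a a1, wS a a1).
exists (C + D) => [|L]; first exact: addr_gt0.
by rewrite mulrDl lerD.
Qed.

Lemma subexp_growsM v w : (forall L, 0 <= v L) -> (forall L, 0 <= w L) ->
  subexp_grows v -> subexp_grows w -> subexp_grows (fun L => v L * w L).
Proof.
move=> v0 w0 vS wS a a1; have [b b1 ba] := ex_root_gt1 2 a1.
have [[C C0 vC] [D D0 wD]] := (vS b b1, wS b b1).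
exists (C * D) => [|L]; first exact: mulr_gt0.
apply: (@le_trans _ _ (C * D * (b ^+ 2) ^+ L)).
  by rewrite expr2 exprMn mulrACA; apply: ler_pM.
rewrite ler_pM2l ?mulr_gt0 // lerXn2r ?nnegrE ?sqr_ge0 //.
by rewrite ltW // (lt_trans ltr01).
Qed.

Lemma subexp_grows_affine w c : (forall L, 0 <= w L) ->
  subexp_grows w -> subexp_grows (fun L => w (c * L.+1)%N).
Proof.
move=> _ wS a a1; have [b b1 ba] := ex_root_gt1 c a1.
have [C C0 wC] := wS b b1; exists (C * a) => [|L].
  by rewrite mulr_gt0 // (lt_trans ltr01).
apply: le_trans (wC _) _; rewrite -mulrA -exprS ler_pM2l // exprM.
by rewrite lerXn2r ?nnegrE ?(ltW (exprn_pos _ _)) // ltW // (lt_trans ltr01).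
Qed.

Lemma exp_growsC c : 0 <= c -> exp_grows (fun=> c).
Proof.
move=> c0; have two1 : 1 < 2 :> R by rewrite ltr1n.
have [C C0 H] := subexp_growsC c0 two1.
by exists 2, C.
Qed.

Lemma exp_growsD v w : (forall L, 0 <= v L) -> (forall L, 0 <= w L) ->
  exp_grows v -> exp_grows w -> exp_grows (fun L => v L + w L).
Proof.
move=> _ _ [a [C [a1 C0 vC]]] [b [D [b1 D0 wD]]].
have [a0 b0] : 0 <= a /\ 0 <= b by rewrite !ltW // (lt_trans ltr01).
exists (Num.max a b), (C + D); split=> [||L].
- by rewrite lt_max a1.
- exact: addr_gt0.
rewrite mulrDl; apply: lerD; [apply: le_trans (vC L) _ | apply: le_trans (wD L) _];
  by rewrite ler_pM2l // lerXn2r ?nnegrE ?le_max ?lexx ?a0 ?orbT.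
Qed.

Lemma exp_growsM v w : (forall L, 0 <= v L) -> (forall L, 0 <= w L) ->
  exp_grows v -> exp_grows w -> exp_grows (fun L => v L * w L).
Proof.
move=> v0 w0 [a [C [a1 C0 vC]]] [b [D [b1 D0 wD]]].
exists (a * b), (C * D); split=> [||L]; [exact: mulr_egt1| exact: mulr_gt0|].
by rewrite exprMn mulrACA; apply: ler_pM.
Qed.

Lemma exp_grows_affine w c : (forall L, 0 <= w L) ->
  exp_grows w -> exp_grows (fun L => w (c * L.+1)%N).
Proof.
move=> _ [a [C [a1 C0 wC]]]; exists (a ^+ c.+1), (C * a ^+ c.+1); split=> [||L].
- by rewrite exprn_egt1.
- by rewrite mulr_gt0 ?exprn_pos.
apply: le_trans (wC _) _; rewrite -mulrA -exprS ler_pM2l // -exprM.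
by apply: exprn_mono => //; rewrite leq_mul2r leqnSn orbT.
Qed.

Definition polynomial_growth :=
  GrowthClass poly_growsC poly_growsD poly_growsM poly_grows_affine.
Definition subexponential_growth :=
  GrowthClass subexp_growsC subexp_growsD subexp_growsM subexp_grows_affine.
Definition exponential_growth :=
  GrowthClass exp_growsC exp_growsD exp_growsM exp_grows_affine.

Lemma polynomial_gauge C k : 0 < C ->
  gauge polynomial_growth (fun L => C * L.+1%:R ^+ k).
Proof.
move=> C0; split=> [L|m n mn|]; first by rewrite mulr_ge0 ?exprn_ge0 // ltW.
  by rewrite ler_pM2l // lerXn2r ?nnegrE // ler_nat.
by exists k, C.
Qed.

Lemma exponential_gauge C a : 0 < C -> 1 < a ->
  gauge exponential_growth (fun L => C * a ^+ L).
Proof.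
move=> C0 a1; split=> [L|m n mn|]; first by rewrite mulr_ge0 ?ltW ?exprn_pos.
  by rewrite ler_pM2l // exprn_mono.
by exists a, C.
Qed.

(** The constants bounding a family of subexponential growth depend on the base
    a, so none of the bounds is itself a gauge; the supremum of F over the elements
    of size at most L is one. *)
Lemma subexponential_gauge (T : Type) (size : T -> nat) (F : T -> R) t0 :
  size t0 = 0%N -> (forall t, 0 <= F t) ->
  (forall a, 1 < a -> exists C, 0 < C /\ forall t, F t <= C * a ^+ size t) ->
  exists w, gauge subexponential_growth w /\ forall t, F t <= w (size t).
Proof.
move=> t00 F0 FS; pose A L := [set F t | t in [set t | (size t <= L)%N]]%classic.
have A_ub a C : 1 < a -> 0 < C -> (forall t, F t <= C * a ^+ size t) ->
    forall L, ubound (A L) (C * a ^+ L).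
  move=> a1 C0 FC L _ [t tL <-]; apply: le_trans (FC t) _.
  by rewrite ler_pM2l // exprn_mono.
have A0 L : (A L !=set0)%classic by exists (F t0), t0 => //=; rewrite t00.
have A_sup L : has_sup (A L).
  split=> //; have [C [C0 FC]] := FS 2 (ltr1n _ 2).
  by exists (C * 2 ^+ L); apply: A_ub => //; rewrite ltr1n.
have F_le t L : (size t <= L)%N -> F t <= sup (A L).
  by move=> tL; apply: sup_upper_bound => //; exists t.
exists (fun L => sup (A L)); split=> [|t]; last exact: F_le.
split=> [L|m n mn|a a1].
- by apply: le_trans (F_le t0 L _); rewrite ?t00.
- apply: ge_sup => // _ [t tm <-]; apply: F_le; exact: leq_trans tm mn.
- have [C [C0 FC]] := FS a a1; exists C => // L.
  by apply: ge_sup => //; apply: A_ub.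
Qed.

Variables (G : groupType) (ell : G -> nat).

(** Products and sums of lengths are compared by
    l_i + 1 <= (l_1 + ... + l_n) + 1 <= (l_1 + 1) ... (l_n + 1). *)
Lemma polynomial_cochains_gauge n (phi : @cochain R G n) :
  phi \in @polynomial_cochains R G ell n <-> exists w,
  gauge polynomial_growth w /\ forall g, `|phi g| <= w (\sum_(i < n) ell (g i))%N.
Proof.
split.
  move=> /asboolP[k [C [C0 phiC]]].
  exists (fun L => C * L.+1%:R ^+ (k * n)); split; first exact: polynomial_gauge.
  move=> g; apply: le_trans (phiC g) _; rewrite ler_pM2l // exprM.
  set y := _.+1%:R ^+ k.
  have -> : y ^+ n = \prod_(i < n) y by rewrite prodr_const card_ord.
  apply: ler_prod => i _; rewrite exprn_ge0 //= lerXn2r ?nnegrE //.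
  by rewrite ler_nat addn1 ltnS (bigD1 i) //= leq_addr.
move=> [w [[_ _ [k [C C0 wC]]] phiw]]; apply/asboolP; exists k, C; split=> // g.
apply: le_trans (phiw g) _; apply: le_trans (wC _) _; rewrite ler_pM2l //.
rewrite prodrXl lerXn2r ?nnegrE ?prodr_ge0 // -natr_prod ler_nat.
by elim/big_ind2: _ => [|x x' y y' xx yy|i _] //; [nia | rewrite addn1].
Qed.

Lemma subexponential_cochains_gauge (ell1 : ell 1%g = 0%N) n (phi : @cochain R G n) :
  phi \in @subexponential_cochains R G ell n <-> exists w,
  gauge subexponential_growth w /\
    forall g, `|phi g| <= w (\sum_(i < n) ell (g i))%N.
Proof.
split.
  move=> /asboolP phiS.
  apply: (@subexponential_gauge _ (fun g : G ^ n => (\sum_(i < n) ell (g i))%N)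
    (fun g => `|phi g|) [ffun=> 1%g]) => //.
  by rewrite big1 // => i _; rewrite ffunE.
move=> [w [[_ _ wS] phiw]]; apply/asboolP => a a1; have [C C0 wC] := wS a a1.
by exists C; split=> // g; apply: le_trans (phiw g) _.
Qed.

Lemma exponential_cochains_gauge n (phi : @cochain R G n) :
  phi \in @exponential_cochains R G ell n <-> exists w,
  gauge exponential_growth w /\ forall g, `|phi g| <= w (\sum_(i < n) ell (g i))%N.
Proof.
split.
  move=> /asboolP[a [C [a1 C0 phiC]]].
  by exists (fun L => C * a ^+ L); split=> //; apply: exponential_gauge.
move=> [w [[_ _ [a [C [a1 C0 wC]]]] phiw]]; apply/asboolP; exists a, C; split=> // g.
by apply: le_trans (phiw g) _.
Qed.

End GrowthClasses.

Theorem corollary8 (R : realType) (G : groupType) (S : seq G)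
    (genS : generates S) :
  (has_polynomial_combing R (word_length genS) ->
     forall n : nat, inclusion_iso (@polynomial_cochains R G (word_length genS)) n)
  /\ (has_subexponential_combing R (word_length genS) ->
     forall n : nat, inclusion_iso (@subexponential_cochains R G (word_length genS)) n)
  /\ (has_exponential_combing R (word_length genS) ->
     forall n : nat, inclusion_iso (@exponential_cochains R G (word_length genS)) n).
Proof.
have iso W := @gauge_inclusion_iso R W G _ (word_length1 genS) (word_lengthM genS)
  (word_lengthV_le genS) (word_length_ball_finite genS).
split; [|split].
- move=> [f [f_comb [C [m [C0 fC]]]]] n.
  apply: (iso _ f _ f_comb (polynomial_gauge m C0)) => [x|].
    by rewrite -addn1.
  exact: polynomial_cochains_gauge.
- move=> [f [f_comb fS]] n.
  have [J [JW fJ]] := subexponential_gauge (word_length1 genS) (fun=> ler0n _ _) fS.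
  apply: (iso _ f _ f_comb JW fJ) => k phi.
  exact: subexponential_cochains_gauge (word_length1 genS) _ phi.
- move=> [f [f_comb [C [a [C0 a1 fC]]]]] n.
  apply: (iso _ f _ f_comb (exponential_gauge C0 a1) fC).
  exact: exponential_cochains_gauge.
Qed.
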